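(* Let $\Omega\subset\mathbb R^d$, $d\ge2$, be a bounded polytope with a conforming simplicial triangulation $\mathcal T_h$, let $k\ge2$ and $r\in\{k-2,k-1\}$. For all $u,v\in\mathring V_k(\mathcal T_h)$, $$(\nabla_w^2u,\nabla_w^2v)=a^{\rm CDG}(u,v),$$ where $\nabla_w^2u:=\nabla_w^2E^{\rm CDG}u$ for $u\in\mathring V_k(\mathcal T_h)$ and $$a^{\rm CDG}(u,v)=\sum_{T\in\mathcal T_h}(\nabla_h^2u,\nabla_h^2v)_T-\sum_{F\in\mathcal F_h}\big[(\{\partial_{nn}u\},[\partial_nv])_F+([\partial_nu],\{\partial_{nn}v\})_F\big]+\tfrac14(\nabla_w^2[\partial_nu],\nabla_w^2[\partial_nv]).$$ Here, for a face function $u_n$ (such as $[\partial_nu]$ or $[\partial_nv]$), $\nabla_w^2u_n:=\nabla_w^2(0,0,u_n,0)$, i.e. $\nabla_w^2u_n$ is the element of $\Sigma_{k,r}^{-1}$ with $(\nabla_w^2u_n,\boldsymbol\tau)_T=(u_n\,\boldsymbol n_F\cdot\boldsymbol n,\ \boldsymbol n^{\intercal}\boldsymbol\tau\boldsymbol n)_{\partial T}$ for all $\boldsymbol\tau\in\Sigma_{k,r}(T;\mathbb S)$ and $T\in\mathcal T_h$.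
   Context: $\mathbb S$: symmetric $d\times d$ matrices. $\mathbb P_k(D)$: polynomials of degree $\le k$ on $D$; $\mathbb H_k$: homogeneous polynomials of degree $k$; $Q_{k,D}$: $L^2(D)$-orthogonal projection onto $\mathbb P_k(D)$. $\mathcal F_h,\mathring{\mathcal F}_h$: all / interior $(d-1)$-dimensional faces; $\mathcal E_h,\mathring{\mathcal E}_h$: all / interior $(d-2)$-dimensional faces; $\Delta_{d-2}(T)$: the $(d-2)$-dimensional faces of $T$. $\nabla_h^2$: element-wise Hessian. $(\cdot,\cdot)_D$: $L^2(D)$ inner product, with $D=\Omega$ when omitted. $\mathring V_k(\mathcal T_h)$: Lagrange element space of continuous piecewise $\mathbb P_k$ functions vanishing on $\partial\Omega$. $\boldsymbol n_F$: fixed unit normal of the face $F$; $\boldsymbol n=\boldsymbol n_{\partial T}$: outward unit normal of $T$. $\operatorname{div}$ of a matrix function is row-wise. Averages and jumps: on an interior face $F$ shared by $T_1,T_2$, $\{w\}=\frac12(w|_{T_1}+w|_{T_2})$ and $[w]=w|_{T_1}\boldsymbol n_F\cdot\boldsymbol n_{\partial T_1}+w|_{T_2}\boldsymbol n_F\cdot\boldsymbol n_{\partial T_2}$, so that $[\partial_nu]=[\partial_{n_F}u]=\partial_{\boldsymbol n_{\partial T_1}}u|_{T_1}+\partial_{\boldsymbol n_{\partial T_2}}u|_{T_2}$. On a boundary face $F\subset\partial T$ the modified convention $[w]=2w|_T$, $\{w\}=\frac12w|_T$ is used, so $[\partial_nu]=2\,\partial_{\boldsymbol n_{\partial T}}u|_T$.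 $\partial_{nn}u=\boldsymbol n^{\intercal}(\nabla^2u)\boldsymbol n$. $\Sigma_{k,r}(T;\mathbb S)=\mathbb P_k(T;\mathbb S)$ if $r=k-2$, and $\mathbb P_k(T;\mathbb S)\oplus\boldsymbol x\boldsymbol x^{\intercal}\mathbb H_{k-1}(T)$ if $r=k-1$; $\Sigma_{k,r}^{-1}=\prod_{T\in\mathcal T_h}\Sigma_{k,r}(T;\mathbb S)$. For $v=(v_0,v_b,v_n,v_e)$ with $v_0|_T\in\mathbb P_r(T)$, $v_b|_F\in\mathbb P_{k-1}(F)$, $v_n|_F\in\mathbb P_k(F)$, $v_e|_e\in\mathbb P_k(e)$ for $T\in\mathcal T_h$, $F\in\mathcal F_h$, $e\in\mathcal E_h$, the weak Hessian $\nabla_w^2v\in\Sigma_{k,r}^{-1}$ is defined by $$(\nabla_w^2v,\boldsymbol\tau)_T=(v_0,\operatorname{div}\operatorname{div}\boldsymbol\tau)_T-(v_b,\operatorname{tr}_2(\boldsymbol\tau))_{\partial T}+(v_n\boldsymbol n_F\cdot\boldsymbol n,\boldsymbol n^{\intercal}\boldsymbol\tau\boldsymbol n)_{\partial T}+\sum_{e\in\Delta_{d-2}(T)}(v_e,\operatorname{tr}_e(\boldsymbol\tau))_e$$ for all $\boldsymbol\tau\in\Sigma_{k,r}(T;\mathbb S)$, $T\in\mathcal T_h$, where $\operatorname{tr}_2(\boldsymbol\tau)=\boldsymbol n^{\intercal}\operatorname{div}\boldsymbol\tau+\operatorname{div}_F(\boldsymbol\tau\boldsymbol n)$ ($\operatorname{div}_F$: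 surface divergence of the tangential part), $\operatorname{tr}_e(\boldsymbol\tau)=\sum_{F\subset\partial T,\,e\subset\partial F}\boldsymbol n_{F,e}^{\intercal}\boldsymbol\tau\,\boldsymbol n_{\partial T}|_F$, and $\boldsymbol n_{F,e}$ is the unit vector tangent to $F$, normal to $e$, pointing out of $F$ (for $d=2$, $e$ is a vertex and $(\cdot,\cdot)_e$ is the product of point values). Embedding: $E^{\rm CDG}u=(Q_{r,T}u,\ Q_{k-1,F}u,\ \{\partial_{n_F}u\}|_F,\ u|_e)_{T\in\mathcal T_h,\,F\in\mathring{\mathcal F}_h,\,e\in\mathring{\mathcal E}_h}$, extended by zero to boundary faces and boundary $(d-2)$-dimensional faces.
   Formalization: The literal last term is wrong for general n_F, since [∂_n u] does not change sign with n_F. Proved for all n_F with n_F·n replaced by 1 (outward normal) in the weak Hessians of the jumps, and literally only when n_F·n is constant on each ∂T. *)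

(* Defs.v *)
From HB Require Import structures.
From mathcomp Require Import all_boot all_order all_algebra.
From mathcomp Require Import all_classical all_reals all_analysis.
From mathcomp.multinomials Require Import -(notations) mpoly.

Set Implicit Arguments.
Unset Strict Implicit.
Unset Printing Implicit Defensive.

Import Order.TTheory GRing.Theory Num.Theory.
Import numFieldNormedType.Exports.

Local Open Scope classical_set_scope.
Local Open Scope ring_scope.

Section Polynomials.
Context {R : realType} {d : nat}.
Local Notation poly := (mpoly d R).
Local Notation vec := 'rV[R]_d.

(* The norm of MathComp-Analysis on row vectors is the sup norm, so Euclidean
   lengths and angles are expressed with this product. *)
Definition dotv (x y : vec) : R := \sum_i x 0 i * y 0 i.

Definition ev (p : poly) : vec -> R := fun x => meval (x 0) p.

Definition deg_le (j : nat) (p : poly) : Prop := (msize p <= j.+1)%N.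

(* derivative in the direction of the constant vector n *)
Definition dirder (n : vec) (p : poly) : poly :=
  \sum_i n 0 i *: mderiv i p.

Definition hessian (p : poly) : 'M[poly]_d :=
  \matrix_(i, j) mderiv i (mderiv j p).

(* Polynomial vector fields are functions 'I_d -> poly. *)
Definition vdot (n : vec) (w : 'I_d -> poly) : poly := \sum_i n 0 i *: w i.

Definition mxvec_prod (t : 'M[poly]_d) (n : vec) : 'I_d -> poly :=
  fun i => \sum_j n 0 j *: t i j.

(* n^T t n *)
Definition nn (n : vec) (t : 'M[poly]_d) : poly := vdot n (mxvec_prod t n).

Definition divv (w : 'I_d -> poly) : poly := \sum_i mderiv i (w i).

Definition row_div (t : 'M[poly]_d) : 'I_d -> poly :=
  fun i => \sum_j mderiv j (t i j).

Definition tangential (n : vec) (w : 'I_d -> poly) : 'I_d -> poly :=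
  fun i => w i - n 0 i *: vdot n w.

(* surface divergence on a hyperplane with unit normal n: the trace of
   (I - n n^T) grad w *)
Definition surf_div (n : vec) (w : 'I_d -> poly) : poly :=
  divv w - vdot n (fun i => dirder n (w i)).

Definition tr2 (n : vec) (t : 'M[poly]_d) : poly :=
  vdot n (row_div t) + surf_div n (tangential n (mxvec_prod t n)).

Definition sym_deg_le (k : nat) (t : 'M[poly]_d) : Prop :=
  t^T = t /\ forall i j, deg_le k (t i j).

Definition xxT (q : poly) : 'M[poly]_d :=
  \matrix_(i, j) (mpolyX R (mnm1 i) * mpolyX R (mnm1 j) * q).

(* The shape functions Sigma_{k,r}(T; S); only r = k - 2 and r = k - 1 are
   meaningful.  They do not depend on T as polynomials. *)
Definition Sigma (k r : nat) (t : 'M[poly]_d) : Prop :=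
  exists2 s, sym_deg_le k s &
    if r == k.-1 then exists2 q, q \is ishomog1 k.-1 mdeg & t = s + xxT q
    else t = s.

End Polynomials.

(* Integral of f over { t in R^m | t_i >= 0, t_1 + ... + t_m <= s }, as an
   iterated one-dimensional Lebesgue integral; for m = 0 the value at the
   point. *)
Fixpoint corner_int {R : realType} (m : nat) (s : R) :
    ('rV[R]_m -> R) -> R :=
  match m with
  | 0%N => fun f => f 0
  | m'.+1 => fun f =>
      \int[lebesgue_measure]_(t in `[0, s])
        corner_int (s - t)
          (fun y : 'rV[R]_m' => f (row_mx (t%:M : 'M[R]_1) y))
  end.

Section Simplices.
Context {R : realType} {d : nat} {V : finType}.
Variable pos : V -> 'rV[R]_d.
Local Notation poly := (mpoly d R).
Local Notation vec := 'rV[R]_d.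

(* A simplex is given by its set of vertices S : {set V}, the vertex v being
   at the point pos v. *)

Definition hull (S : {set V}) : set vec :=
  [set x | exists c : V -> R, [/\ forall v, v \in S -> 0 <= c v,
     \sum_(v in S) c v = 1 & x = \sum_(v in S) c v *: pos v]].

Definition affinely_independent (S : {set V}) : Prop :=
  forall c : V -> R, \sum_(v in S) c v = 0 ->
    \sum_(v in S) c v *: pos v = 0 -> forall v, v \in S -> c v = 0.

Definition vertex (S : {set V}) (i : nat) : vec :=
  nth 0 [seq pos v | v <- enum S] i.

Definition edges (S : {set V}) : 'M[R]_(#|S|.-1, d) :=
  \matrix_(i < #|S|.-1) (vertex S i.+1 - vertex S 0).

(* Integral over hull S for the Hausdorff measure of the dimension #|S| - 1 of
   the simplex, by pulling back along the affine parametrization of hull S;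
   sqrt (det (A A^T)) is its Jacobian.  When #|S| = 1 it is the value at the
   vertex. *)
Definition simplex_int (S : {set V}) (f : vec -> R) : R :=
  Num.sqrt (\det (edges S *m (edges S)^T)) *
  corner_int 1 (fun t => f (vertex S 0 + t *m edges S)).

Definition ip (S : {set V}) (f g : vec -> R) : R :=
  simplex_int S (fun x => f x * g x).

Definition ip_mx (S : {set V}) (s t : 'M[poly]_d) : R :=
  \sum_i \sum_j ip S (ev (s i j)) (ev (t i j)).

(* L^2(hull S)-orthogonal projection onto P_j(hull S).  When hull S is
   lower-dimensional, P_j(hull S) consists of the restrictions of the
   polynomials of degree at most j, and only the restriction of the result is
   meaningful. *)
Definition L2proj (j : nat) (S : {set V}) (f : vec -> R) : poly :=
  xget 0 [set p | deg_le j p /\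
    forall q, deg_le j q -> ip S (ev p) (ev q) = ip S f (ev q)].

(* codimension-one and codimension-two faces of a simplex *)
Definition facets (S : {set V}) : {set {set V}} :=
  [set F : {set V} | (F \subset S) && (#|F|.+1 == #|S|)].
Definition ridges (S : {set V}) : {set {set V}} :=
  [set e : {set V} | (e \subset S) && (#|e|.+2 == #|S|)].

Definition unit_normal (F : {set V}) (n : vec) : Prop :=
  dotv n n = 1 /\
  forall p q, p \in F -> q \in F -> dotv n (pos p - pos q) = 0.

(* The unit vector tangent to the simplex S, normal to its facet F and pointing
   out of S.  With S a cell T this is n_{dT} on F; with S a face F and F one
   of its facets e this is n_{F,e}. *)
Definition conormal (S F : {set V}) : vec :=
  xget 0 [set n | [/\ unit_normal F n,
    forall p q, p \in F -> q \in S :\: F -> 0 < dotv n (pos p - pos q) &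
    exists2 c : V -> R, \sum_(v in S) c v = 0 &
      n = \sum_(v in S) c v *: pos v]].

Definition tr_e (T e : {set V}) (t : 'M[poly]_d) : poly :=
  \sum_(F in facets T | e \subset F)
     vdot (conormal F e) (mxvec_prod t (conormal T F)).

(* v = (v_0, v_b, v_n, v_e), as functions indexed by cells, faces, faces and
   (d-2)-dimensional faces; only the values of each component on the simplex
   that indexes it are used. *)
Record weak_fun := WeakFun {
  w_0 : {set V} -> vec -> R;
  w_b : {set V} -> vec -> R;
  w_n : {set V} -> vec -> R;
  w_e : {set V} -> vec -> R }.

(* The restriction of the weak Hessian to the cell T, for the face normals
   nF. *)
Definition whess (k r : nat) (nF : {set V} -> vec) (v : weak_fun)
    (T : {set V}) : 'M[poly]_d :=
  xget 0 [set W | Sigma k r W /\ forall t, Sigma k r t ->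
    ip_mx T W t =
      ip T (w_0 v T) (ev (divv (row_div t)))
      - \sum_(F in facets T) ip F (w_b v F) (ev (tr2 (conormal T F) t))
      + \sum_(F in facets T)
          ip F (fun x => w_n v F x * dotv (nF F) (conormal T F))
               (ev (nn (conormal T F) t))
      + \sum_(e in ridges T) ip e (w_e v e) (ev (tr_e T e t))].

(* the weak function (0, 0, un, 0) *)
Definition face_fun (un : {set V} -> vec -> R) : weak_fun :=
  WeakFun (fun _ _ => 0) (fun _ _ => 0) un (fun _ _ => 0).

End Simplices.

Section Mesh.
Context {R : realType} {d : nat} {V : finType}.
Variables (pos : V -> 'rV[R]_d) (Omega : set 'rV[R]_d).
Variable cells : {set {set V}}.
Local Notation poly := (mpoly d R).
Local Notation vec := 'rV[R]_d.

Definition boundary : set vec := closure Omega `\` Omega.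

(* A bounded polytope is an open set that is the interior of its closure
   and whose closure is a finite union of d-simplices. *)
Record triangulation : Prop := Triangulation {
  omega_open : open Omega;
  omega_regular : interior (closure Omega) = Omega;
  omega_cover :
    closure Omega = [set x | exists2 T, T \in cells & hull pos T x];
  cells_dim : forall T, T \in cells -> #|T| = d.+1;
  cells_affine : forall T, T \in cells -> affinely_independent pos T;
  cells_conforming : forall T T', T \in cells -> T' \in cells ->
    hull pos T `&` hull pos T' = hull pos (T :&: T') }.

Definition faces : {set {set V}} := \bigcup_(T in cells) facets T.

Definition star (F : {set V}) : {set {set V}} :=
  [set T in cells | F \subset T].

(* A face is interior when two cells share it, and otherwise lies in a single
   cell and on the boundary. *)
Definition interior_face (F : {set V}) : bool := #|star F| == 2.

Definition interior_ridge (e : {set V}) : bool :=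
  ~~ `[< hull pos e `<=` boundary >].

(* For a piecewise polynomial w.  The average is half the sum of the traces on
   interior and, by the modified convention, on boundary faces. *)
Definition average (w : {set V} -> poly) (F : {set V}) : poly :=
  2^-1 *: \sum_(T in star F) w T.

Definition jump (nF : {set V} -> vec) (w : {set V} -> poly) (F : {set V}) :
    poly :=
  if interior_face F
  then \sum_(T in star F) dotv (nF F) (conormal pos T F) *: w T
  else 2 *: \sum_(T in star F) w T.

(* Lagrange space of degree k with zero boundary values *)
Definition lagrange0 (k : nat) (u : vec -> R) : Prop :=
  [/\ {within closure Omega, continuous u},
      forall x, boundary x -> u x = 0 &
      forall T, T \in cells -> exists2 p : poly, deg_le k p &
        forall x, hull pos T x -> u x = ev p x].

(* the polynomial that coincides with u on the cell T *)
Definition piece (k : nat) (u : vec -> R) (T : {set V}) : poly :=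
  xget 0 [set p | deg_le k p /\ forall x, hull pos T x -> u x = ev p x].

Definition avg_dnn (k : nat) (u : vec -> R) (F : {set V}) : poly :=
  average (fun T => nn (conormal pos T F) (hessian (piece k u T))) F.

(* [d_n u]: the jump of d_{n_F} u on interior faces, and 2 d_n u with n the
   outward normal on boundary faces *)
Definition jump_dn (k : nat) (nF : {set V} -> vec) (u : vec -> R)
    (F : {set V}) : poly :=
  jump nF (fun T => dirder (if interior_face F then nF F else conormal pos T F)
                           (piece k u T)) F.

(* the embedding E^CDG of lagrange0 k into the weak functions *)
Definition E_CDG (k r : nat) (nF : {set V} -> vec) (u : vec -> R) :
    weak_fun :=
  WeakFun
    (fun T => ev (L2proj pos r T u))
    (fun F => if interior_face F then ev (L2proj pos k.-1 F u) else fun=> 0)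
    (fun F => if interior_face F
              then ev (average (fun T => dirder (nF F) (piece k u T)) F)
              else fun=> 0)
    (fun e => if interior_ridge e then u else fun=> 0).

Definition ip_cells (s t : {set V} -> 'M[poly]_d) : R :=
  \sum_(T in cells) ip_mx pos T (s T) (t T).

Definition whess_CDG (k r : nat) (nF : {set V} -> vec) (u : vec -> R) :
    {set V} -> 'M[poly]_d :=
  whess pos k r nF (E_CDG k r nF u).

(* Weak Hessian of the face function [d_n u], where the normal that orients the
   term (u_n n_F . n, n^T t n)_F on the boundary of the cell T is m T F.
   Pitfall: [d_n u] does not change sign with n_F, so for this function, unlike
   for {d_{n_F} u}, that term depends on the orientation.  Integration by parts
   on T gives whess_CDG u = hessian u - whess_jump u / 2 with the outward normal
   m T F = conormal T F, for which n_F . n = 1 on the boundary of T.  With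
   m T F = nF F the cross terms between two facets of T on which nF . n has
   opposite signs acquire the wrong sign. *)
Definition whess_jump (k r : nat) (nF : {set V} -> vec)
    (m : {set V} -> {set V} -> vec) (u : vec -> R) :
    {set V} -> 'M[poly]_d :=
  fun T => whess pos k r (m T) (face_fun (fun F => ev (jump_dn k nF u F))) T.

Definition a_CDG (k r : nat) (nF : {set V} -> vec)
    (m : {set V} -> {set V} -> vec) (u v : vec -> R) : R :=
  ip_cells (fun T => hessian (piece k u T)) (fun T => hessian (piece k v T))
  - \sum_(F in faces)
      (ip pos F (ev (avg_dnn k u F)) (ev (jump_dn k nF v F))
       + ip pos F (ev (jump_dn k nF u F)) (ev (avg_dnn k v F)))
  + 4^-1 * ip_cells (whess_jump k r nF m u) (whess_jump k r nF m v).

(* On every cell the fixed normals all point outwards or all point inwards. *)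
Definition cellwise_oriented (nF : {set V} -> vec) : Prop :=
  forall T, T \in cells -> exists s : R,
    forall F, F \in facets T -> dotv (nF F) (conormal pos T F) = s.

End Mesh.

(* Main.v *)
(** On a cell T, integration by parts gives, for a polynomial u and every tau in
    Sigma_{k,r}, (hess u, tau) = (u, div div tau) - (u, tr_2 tau) +
    (d_n u, n^T tau n) + sum_e (u, tr_e tau)_e.  The degrees of div div tau and
    of tr_2 tau on a face allow the L2 projections in E^CDG to be dropped, and
    {d_{n_F} u} n_F . n = d_n u - [d_n u] / 2, so the weak Hessian of u is
    hess u - G u / 2, where (G u, tau) = ([d_n u], n^T tau n) on the boundary of
    T.  Expanding (hess u - G u / 2, hess v - G v / 2) and gathering the face
    terms of the two cells sharing a face yields the bilinear form.

    The integration theory of simplices rests on the formula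
    int lambda^alpha = J alpha! / (|alpha| + m)! for barycentric monomials on an
    m-simplex of Jacobian J.  It turns the divergence theorem on a simplex into
    an identity between monomials, together with J(S) = h J(F) for the height h
    of S over its facet F. *)
Require Import Defs.
From HB Require Import structures.
From mathcomp Require Import all_boot all_order all_algebra.
From mathcomp Require Import all_classical all_reals all_analysis.
From mathcomp.multinomials Require Import -(notations) mpoly.
From mathcomp Require Import ring lra zify.
Set Implicit Arguments.
Unset Strict Implicit.
Unset Printing Implicit Defensive.

Import Order.TTheory GRing.Theory Num.Theory.
Import numFieldNormedType.Exports.

Local Open Scope classical_set_scope.
Local Open Scope ring_scope.


(** * Integrals over the corner simplex *)

(** Conormals, projections and weak Hessians are picked by [xget], so their defining equations hold
    only once existence is proved. For the last two this is a finite-dimensional Riesz argument; on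
    a face the L2 form is merely semidefinite on polynomials in [d] variables, so solvability of a
    symmetric system replaces invertibility. The iterated integral depends on an enumeration of the
    vertices and singles out a base point, so integrals over a simplex and over its facets are not
    visibly related. The monomial formula is symmetric in the vertices and removes this dependence.
    Integrands stay polynomial, which makes linearity a matter of coefficients. The enrichment
    [x x^T q] gives [tr2] one degree too many, but [n . x] is constant on a face and the degree
    drops again. Conformity must yield that at most two cells share a face, that their conormals are
    opposite, and that an unshared face lies on the boundary; all of this rests on small
    displacements off a face. The sign orienting the jump term is constant on each cell and enters
    only through its square. *)

Section CornerIntegral.
Context {R : realType}.
Implicit Types (s : R) (p : {poly R}).

(** Euler's beta integral, with an explicit polynomial primitive so that only the fundamental
    theorem of calculus is needed later. *)
Lemma beta_primitive s (a N : nat) : exists2 B : {poly R},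
  B^`() = 'X^a * (s%:P - 'X) ^+ N &
  B.[s] - B.[0] = (a`! * N`!)%:R / ((a + N).+1)`!%:R * s ^+ (a + N).+1.
Proof.
elim: a N => [|a IH] N.
  exists (- N.+1%:R^-1 *: (s%:P - 'X) ^+ N.+1).
    rewrite derivZ deriv_exp derivB derivC derivX sub0r /= mulN1r mulNrn.
    rewrite scalerN scaleNr opprK -scalerMnr scalerMnl -(mulr_natr _^-1).
    by rewrite mulVf ?pnatr_eq0 // scale1r expr0 mul1r.
  rewrite !(hornerZ, horner_exp, hornerD, hornerN, hornerC, hornerX).
  rewrite subrr expr0n mulr0 sub0r subr0 mulNr opprK mul1n add0n factS natrM.
  have := pnatr_eq0 R N`!; rewrite eqn0Ngt fact_gt0 /= => /negbT h.
  by rewrite invfM mulrCA divff // mulr1.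
(* Integration by parts lowers the exponent of ['X] and raises that of [s - 'X], so [N] has to stay
   general in the induction. *)
have [B dB eB] := IH N.+1.
exists (N.+1%:R^-1 *: (a.+1%:R *: B - 'X^(a.+1) * (s%:P - 'X) ^+ N.+1)).
  rewrite derivZ derivB derivZ dB derivM derivXn deriv_exp derivB derivC derivX.
  rewrite sub0r /= mulN1r mulNrn mulrN opprB mulrnAl scaler_nat addrC subrK.
  rewrite mulrnAr -[X in _ *: X = _]scaler_nat scalerA.
  by rewrite mulVf ?pnatr_eq0 // scale1r.
rewrite !(hornerZ, hornerM, horner_exp, hornerD, hornerN, hornerC, hornerX).
rewrite subrr !expr0n mulr0 mul0r !subr0 -mulrBr -mulrBr eB.
rewrite addSnnS -[in RHS]addSnnS addSnnS.
rewrite (factS a) (factS N) !natrM !mulrA; congr (_ / _ * _).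
by rewrite [_ * N.+1%:R]mulrC !mulrA divff ?mul1r // pnatr_eq0.
Qed.

Lemma Rintegral_deriv_poly p s : 0 <= s ->
  \int[lebesgue_measure]_(t in `[0, s]) p^`().[t] = p.[s] - p.[0].
Proof.
rewrite le_eqVlt => /predU1P[<-|s0].
  by rewrite set_itv1 Rintegral_set1 subrr.
rewrite /Rintegral (@continuous_FTC2 _ _ (horner p)) //.
- by apply: continuous_subspaceT; exact: continuous_horner.
- split.
  + by move=> x _; exact: derivable_horner.
  + by apply: cvg_at_right_filter; exact: continuous_horner.
  + by apply: cvg_at_left_filter; exact: continuous_horner.
- by move=> x _; rewrite -derivE.
Qed.

(** Treating the whole sum at once, through a single polynomial primitive, avoids the integrability
    conditions of termwise integration. *)
Lemma Rintegral_sum_beta (J : Type) (r : seq J) (c : J -> R)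
    (a N : J -> nat) s :
  0 <= s ->
  \int[lebesgue_measure]_(t in `[0, s])
     (\sum_(j <- r) c j * (t ^+ a j * (s - t) ^+ N j)) =
  \sum_(j <- r) c j * ((a j)`! * (N j)`!)%:R / ((a j + N j).+1)`!%:R
     * s ^+ (a j + N j).+1.
Proof.
move=> s0.
pose B j := projT1 (cid2 (beta_primitive s (a j) (N j))).
have dB j : (B j)^`() = 'X^(a j) * (s%:P - 'X) ^+ N j.
  by rewrite /B; case: cid2.
have eB j : (B j).[s] - (B j).[0] = ((a j)`! * (N j)`!)%:R
    / ((a j + N j).+1)`!%:R * s ^+ (a j + N j).+1.
  by rewrite /B; case: cid2.
pose P := \sum_(j <- r) c j *: B j.
transitivity (P.[s] - P.[0]).
  rewrite -Rintegral_deriv_poly //; apply: eq_Rintegral => t _.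
  rewrite /P (raddf_sum (deriv (R := R))) horner_sum; apply: eq_bigr => j _.
  by rewrite /= derivZ dB !hornerE.
rewrite /P !horner_sum -sumrB; apply: eq_bigr => j _.
by rewrite !hornerZ -mulrBr eB !mulrA.
Qed.

Lemma row_cons0 (m : nat) (t : R) (y : 'rV[R]_m) :
  (row_mx (t%:M : 'M[R]_1) y : 'rV[R]_(m.+1)) 0 ord0 = t.
Proof.
have := @row_mxEl R 1 1 m t%:M y 0 ord0.
rewrite [in X in _ = X]mxE eqxx mulr1n => {2}<-.
by rewrite /ord0; congr (fun_of_matrix _ _ _); apply/val_inj.
Qed.

Lemma row_consS (m : nat) (t : R) (y : 'rV[R]_m) (i : 'I_m) :
  (row_mx (t%:M : 'M[R]_1) y : 'rV[R]_(m.+1)) 0 (lift ord0 i) = y 0 i.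
Proof.
have := @row_mxEr R 1 1 m t%:M y 0 i => <-.
by congr (fun_of_matrix _ _ _); apply/val_inj.
Qed.

(** Dirichlet's integral. The slice at first coordinate [t] integrates to a multiple of a power of
    [s - t], so each induction step is one beta integral. The factor with exponent [b j] is the
    barycentric coordinate of the base vertex. *)
Lemma corner_int_sum (m : nat) (J : Type) (r : seq J) (c : J -> R)
    (a : J -> 'I_m -> nat) (b : J -> nat) s : 0 <= s ->
  corner_int s (fun t : 'rV[R]_m => \sum_(j <- r)
    c j * (\prod_i t 0 i ^+ a j i * (s - \sum_i t 0 i) ^+ b j)) =
  \sum_(j <- r) c j * ((\prod_i (a j i)`!) * (b j)`!)%:R
     / ((\sum_i a j i + b j + m)`!)%:R * s ^+ (\sum_i a j i + b j + m).
Proof.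
elim: m c a b s => [|m IH] c a b s s0 /=.
  apply: eq_bigr => j _; rewrite !big_ord0 subr0 !mul1r mul1n add0n addn0.
  by rewrite -[c j * _ / _]mulrA divff ?mulr1 // pnatr_eq0 -lt0n fact_gt0.
pose a' j (i : 'I_m) := a j (lift ord0 i).
transitivity (\int[lebesgue_measure]_(t in `[0, s]) \sum_(j <- r)
   (c j * ((\prod_i (a' j i)`!) * (b j)`!)%:R
     / ((\sum_i a' j i + b j + m)`!)%:R)
     * (t ^+ a j ord0 * (s - t) ^+ (\sum_i a' j i + b j + m))).
  apply: eq_Rintegral => t; rewrite inE /= in_itv /= => /andP[t0 ts].
  have {}ts : 0 <= s - t by rewrite subr_ge0.
  transitivity (corner_int (s - t) (fun y : 'rV[R]_m => \sum_(j <- r)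
     (c j * t ^+ a j ord0) * (\prod_i y 0 i ^+ a' j i *
       (s - t - \sum_i y 0 i) ^+ b j))).
    congr (corner_int _ _); apply/funext => y; apply: eq_bigr => j _.
    have e0 := row_cons0 t y; have eS := row_consS t y.
    rewrite !big_ord_recl e0 -!mulrA opprD addrA; congr (_ * (_ * (_ * _ ^+ _))).
      by apply: eq_bigr => i _; rewrite eS.
    by congr (_ - _); apply: eq_bigr => i _; rewrite eS.
  rewrite IH //; apply: eq_bigr => j _; rewrite -!mulrA; congr (_ * _).
  by rewrite mulrCA; congr (_ * _); rewrite mulrCA.
rewrite Rintegral_sum_beta //; apply: eq_bigr => j _.
rewrite !big_ord_recl addnS -!addnA -/(a' j) -/(a' j _).
set e := (a j ord0 + _)%N; set M := (\sum_(i < m) a' j i + _)%N.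
congr (_ * _); rewrite -!mulrA; congr (_ * _); rewrite !natrM.
have M0 : (M`!)%:R != 0 :> R by rewrite pnatr_eq0 -lt0n fact_gt0.
rewrite !mulrA [_ * (a j ord0)`!%:R]mulrC !mulrA; congr (_ / _).
by rewrite -!mulrA; congr (_ * (_ * _)); rewrite mulVf // mulr1.
Qed.

Lemma eq_corner_int (m : nat) (f g : 'rV[R]_m -> R) s :
  (forall t : 'rV[R]_m, (forall i, 0 <= t 0 i) -> \sum_i t 0 i <= s ->
    f t = g t) ->
  0 <= s -> corner_int s f = corner_int s g.
Proof.
elim: m f g s => [|m IH] f g s fg s0 /=.
  by apply: fg => [[]//|]; rewrite big_ord0.
apply: eq_Rintegral => t; rewrite inE /= in_itv /= => /andP[t0 ts].
apply: IH; last by rewrite subr_ge0.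
move=> y y0 ys; apply: fg => [i|].
  by case: (unliftP ord0 i) => [j|] ->; rewrite ?row_consS ?row_cons0.
rewrite big_ord_recl row_cons0 addrC -lerBrDr (le_trans _ ys) //.
by apply: ler_sum => i _; rewrite row_consS.
Qed.

Lemma corner_int_ge0 (m : nat) (f : 'rV[R]_m -> R) s :
  (forall t, 0 <= f t) -> 0 <= corner_int s f.
Proof.
elim: m f s => [|m IH] f s f0 /=; first exact: f0.
by apply: Rintegral_ge0 => t _; apply: IH.
Qed.

End CornerIntegral.

(** * Gram determinants *)

Section Gram.
Context {R : realType} {d : nat}.
Local Notation vec := 'rV[R]_d.

Lemma dotvE (x y : vec) : dotv x y = (x *m y^T) 0 0.
Proof. by rewrite mxE; apply: eq_bigr => i _; rewrite mxE. Qed.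

Lemma dotvC (x y : vec) : dotv x y = dotv y x.
Proof. by apply: eq_bigr => i _; rewrite mulrC. Qed.

Lemma dotv_linearl (a : R) (x y z : vec) :
  dotv (a *: x + y) z = a * dotv x z + dotv y z.
Proof.
rewrite mulr_sumr -big_split /=; apply: eq_bigr => i _.
by rewrite !mxE mulrDl mulrA.
Qed.

Lemma dotvDl (x y z : vec) : dotv (x + y) z = dotv x z + dotv y z.
Proof. by have := dotv_linearl 1 x y z; rewrite scale1r mul1r. Qed.

Lemma dotv0l (z : vec) : dotv 0 z = 0.
Proof. by apply: big1 => i _; rewrite mxE mul0r. Qed.

Lemma dotvZl (a : R) (x z : vec) : dotv (a *: x) z = a * dotv x z.
Proof. by have := dotv_linearl a x 0 z; rewrite addr0 dotv0l addr0. Qed.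

Lemma dotvNl (x z : vec) : dotv (- x) z = - dotv x z.
Proof. by rewrite -scaleN1r dotvZl mulN1r. Qed.

Lemma dotvBl (x y z : vec) : dotv (x - y) z = dotv x z - dotv y z.
Proof. by rewrite dotvDl dotvNl. Qed.

Lemma dotvDr (x y z : vec) : dotv z (x + y) = dotv z x + dotv z y.
Proof. by rewrite !(dotvC z) dotvDl. Qed.

Lemma dotvZr (a : R) (x z : vec) : dotv z (a *: x) = a * dotv z x.
Proof. by rewrite !(dotvC z) dotvZl. Qed.

Lemma dotvBr (x y z : vec) : dotv z (x - y) = dotv z x - dotv z y.
Proof. by rewrite !(dotvC z) dotvBl. Qed.

Lemma dotvNr (x z : vec) : dotv z (- x) = - dotv z x.
Proof. by rewrite !(dotvC z) dotvNl. Qed.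

Lemma dotv0r (z : vec) : dotv z 0 = 0.
Proof. by rewrite dotvC dotv0l. Qed.

Lemma dotv_suml (I : Type) (r : seq I) (P : pred I) (F : I -> vec) (z : vec) :
  dotv (\sum_(i <- r | P i) F i) z = \sum_(i <- r | P i) dotv (F i) z.
Proof.
elim/big_rec2: _ => [|i y1 y2 _ <-]; first exact: dotv0l.
by rewrite dotvDl.
Qed.

Lemma dotv_sumr (I : Type) (r : seq I) (P : pred I) (F : I -> vec) (z : vec) :
  dotv z (\sum_(i <- r | P i) F i) = \sum_(i <- r | P i) dotv z (F i).
Proof. by rewrite dotvC dotv_suml; apply: eq_bigr => i _; rewrite dotvC. Qed.

Lemma dotv_ge0 (x : vec) : 0 <= dotv x x.
Proof. by apply: sumr_ge0 => i _; rewrite -expr2 sqr_ge0. Qed.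

Lemma dotv_eq0 (x : vec) : dotv x x = 0 -> x = 0.
Proof.
move=> /eqP; rewrite psumr_eq0 => [|i _]; last by rewrite -expr2 sqr_ge0.
move=> /allP x0; apply/rowP => i; rewrite mxE.
by have := x0 i (mem_index_enum _); rewrite -expr2 sqrf_eq0 => /eqP.
Qed.

(* Cramer's rule: h c_j = |n|^2 = 1 and det G c_j = h adj(G)_jj for G = A A^T,
   n = c A. *)
Lemma gram_cofactor (m : nat) (A : 'M[R]_(m.+1, d)) (j : 'I_m.+1)
    (c : 'rV[R]_m.+1) (h : R) :
  dotv (c *m A) (c *m A) = 1 -> A *m (c *m A)^T = h *: delta_mx j 0 ->
  \det (A *m A^T) = h ^+ 2 * \det (row' j A *m (row' j A)^T).
Proof.
set n := c *m A; move=> n1 An.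
set G := A *m A^T.
have nA : c *m G = h *: delta_mx 0 j.
  rewrite mulmxA -/n -[LHS]trmxK trmx_mul trmxK An linearZ /=.
  by rewrite trmx_delta.
have hc : h * c 0 j = 1.
  rewrite -n1 dotvE -mulmxA An -scalemxAr !mxE; congr (_ * _).
  rewrite (bigD1 j) //= big1 => [|i ij]; last by rewrite mxE (negbTE ij) mulr0.
  by rewrite mxE !eqxx mulr1 addr0.
have dc : \det G *: c = h *: row j (\adj G).
  by rewrite rowE scalemxAl -nA -mulmxA mul_mx_adj mul_mx_scalar.
have := congr1 (fun M : 'rV[R]_m.+1 => h * M 0 j) dc.
rewrite !mxE mulrCA hc mulr1 mulrA -expr2 => ->; congr (_ * _).
rewrite /cofactor addnn -mul2n exprM sqrrN expr1n expr1n mul1r.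
congr (\det _); apply/matrixP => i k; rewrite !mxE.
by apply: eq_bigr => l _; rewrite !mxE.
Qed.

(** Same matrix as [edges], for points indexed by naturals: the facet opposite to [x j] is then
    [x \o bump j], with no dependent sizes. *)
Definition dmx (m : nat) (x : nat -> vec) : 'M[R]_(m, d) :=
  \matrix_(i < m) (x i.+1 - x 0).

Definition gram (m : nat) (x : nat -> vec) : R :=
  \det (dmx m x *m (dmx m x)^T).

Lemma eq_gram (m : nat) (x y : nat -> vec) :
  (forall i, (i <= m)%N -> x i = y i) -> gram m x = gram m y.
Proof.
move=> xy; rewrite /gram; suff -> : dmx m x = dmx m y by [].
by apply/row_matrixP => i; rewrite !rowK !xy.
Qed.

Definition swap01 (i : nat) : nat :=
  match i with 0 => 1 | 1 => 0 | i'.+2 => i'.+2 end.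

(** The base point plays a special role in the edge matrix. Exchanging it with the next point
    multiplies that matrix by a triangular [U] of determinant -1, which squares away. *)
Lemma gram_swap (m : nat) (x : nat -> vec) :
  gram m.+1 (x \o swap01) = gram m.+1 x.
Proof.
pose U : 'M[R]_m.+1 :=
  \matrix_(i, j) (if i == 0 then - (j == 0)%:R else (i == j)%:R - (j == 0)%:R).
have UA : dmx m.+1 (x \o swap01) = U *m dmx m.+1 x.
  apply/row_matrixP => i; rewrite rowK row_mul /=.
  have -> : row i U *m dmx m.+1 x = \sum_j U i j *: row j (dmx m.+1 x).
    by rewrite mulmx_sum_row; apply: eq_bigr => j _; rewrite mxE.
  case: (unliftP 0 i) => [k ->|->].
    rewrite (bigD1 0) //= (bigD1 (lift 0 k)) //= big1 => [|j /andP[j0 jk]].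
      have -> : U (lift 0 k) 0 = -1 by rewrite mxE /= sub0r.
      have -> : U (lift 0 k) (lift 0 k) = 1 by rewrite mxE /= eqxx subr0.
      rewrite !rowK scale1r scaleN1r.
      by rewrite addr0 opprB addrC subrKA.
    by rewrite mxE /= (negbTE j0) eq_sym (negbTE jk) subr0 scale0r.
  rewrite (bigD1 0) //= big1 => [|j j0].
    by rewrite mxE !eqxx scaleN1r rowK addr0 opprB.
  by rewrite mxE eqxx (negbTE j0) oppr0 scale0r.
have dU : \det U = -1.
  rewrite det_trig; last first.
    apply/is_trig_mxP => i j ij; rewrite mxE.
    have j0 : j == 0 = false by apply/negP => /eqP j0; move: ij; rewrite j0.
    have ij' : i == j = false by apply/negP => /eqP e; move: ij; rewrite e ltnn.
    by case: ifP => _; rewrite j0 ?ij' ?subr0 // oppr0.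
  rewrite (bigD1 0) //= mxE !eqxx big1 ?mulr1 // => i i0.
  by rewrite mxE (negbTE i0) eqxx subr0.
rewrite /gram UA trmx_mul mulmxA -(mulmxA U) !det_mulmx det_tr dU.
by rewrite mulN1r mulrN1 opprK.
Qed.

(** Volume is base times height, squared: [n] is the unit normal to the facet inside the span of the
    simplex and [h] the height of [x j] over it. *)
Lemma gram_height (m : nat) (x : nat -> vec) (j : nat) (c : nat -> R) (h : R) :
  (j <= m.+1)%N -> \sum_(i < m.+2) c i = 0 ->
  let n := \sum_(i < m.+2) c i *: x i in
  dotv n n = 1 ->
  (forall i, (i <= m.+1)%N -> i != j -> dotv n (x i - x j) = h) ->
  gram m.+1 x = h ^+ 2 * gram m (x \o bump j).
Proof.
(* [gram_cofactor] deletes a row of the edge matrix, that is, a vertex other than the base point;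
   for [j = 0] the first two vertices are exchanged. *)
wlog j0 : x c j / (0 < j)%N => [H jm c0 n n1 nh|].
  case: (posnP j) => [j0|]; last by move=> j0; apply: (H x c j).
  subst j.
  have e2 (V : zmodType) (F : nat -> V) :
      \sum_(i < m.+2) F (swap01 i) = \sum_(i < m.+2) F i.
    by rewrite !big_ord_recl /= addrCA.
  have en : \sum_(i < m.+2) (c \o swap01) i *: (x \o swap01) i = n.
    exact: (e2 _ (fun i => c i *: x i)).
  rewrite -gram_swap; transitivity (h ^+ 2 * gram m ((x \o swap01) \o bump 1)).
    apply: (H _ (c \o swap01)) => //; rewrite ?en ?(e2 _ c) //.
    by case=> [|[|i]] im // _; apply: nh.
  by congr (_ * _); apply: eq_gram; case=> [|[|i]].
case: j j0 => // j _ jm c0 n n1 nh.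
pose j' : 'I_m.+1 := Ordinal jm.
have -> : gram m (x \o bump j.+1) =
    \det (row' j' (dmx m.+1 x) *m (row' j' (dmx m.+1 x))^T).
  rewrite /gram; suff -> : dmx m (x \o bump j.+1) = row' j' (dmx m.+1 x) by [].
  apply/row_matrixP => i; rewrite rowK rowE.
  by apply/rowP => k; rewrite -rowE !mxE /= bumpS.
pose cr : 'rV[R]_m.+1 := \row_i c i.+1.
have en : cr *m dmx m.+1 x = n.
  rewrite mulmx_sum_row /n [RHS]big_ord_recl /=.
  have -> : c 0%N = - \sum_(i < m.+1) c i.+1.
    by apply/eqP; rewrite -addr_eq0 -[X in _ == X]c0 [X in _ == X]big_ord_recl.
  rewrite scaleNr scaler_suml addrC -sumrB; apply: eq_bigr => i _.
  by rewrite mxE rowK scalerBr.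
(* The edge from [x 0] to [x j.+1] goes against [n], so the height enters [gram_cofactor] as
   [- h]. *)
rewrite -[RHS]mulr1 -(sqrrN h) mulr1.
apply: (@gram_cofactor _ _ j' cr); rewrite en //.
apply/colP => i; rewrite !mxE.
transitivity (dotv n (x i.+1 - x 0%N)).
  by apply: eq_bigr => k _; rewrite !mxE mulrC.
have n0 := nh 0%N isT isT.
have [->|ij] := eqVneq i j'.
  by rewrite mulr1 /= -opprB dotvNr n0.
rewrite mulr0.
have -> : x i.+1 - x 0%N = (x i.+1 - x j.+1) - (x 0%N - x j.+1).
  by rewrite opprB addrA subrK.
by rewrite dotvBr n0 nh ?subrr // ltn_ord.
Qed.

End Gram.

(** * Solvability of symmetric semidefinite systems *)

Section Riesz.
Context {R : realType}.

(* The right-hand side is orthogonal to the isotropic vectors of G, in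
   particular to its kernel, hence lies in the row space of G. *)
Lemma sym_solvable (N : nat) (G : 'M[R]_N) (l : 'cV[R]_N) :
  G^T = G -> (forall c : 'cV_N, c^T *m G *m c = 0 -> c^T *m l = 0) ->
  exists c : 'cV_N, G *m c = l.
Proof.
move=> Gs Gl.
have : (l^T <= G)%MS.
  rewrite submxE; apply/eqP/trmx_inj; rewrite trmx_mul trmxK trmx0.
  apply/row_matrixP => i; rewrite row_mul -tr_col row0; apply: Gl.
  by rewrite -mulmxA colE (mulmxA G) mulmx_coker mul0mx mulmx0.
case/submxP => D lD; exists D^T.
by rewrite -[l]trmxK lD trmx_mul Gs.
Qed.

(** The degenerate case of the Cauchy-Schwarz inequality. *)
Lemma psd_eq0 (E : lmodType R) (B : E -> E -> R) :
  (forall a x y z, B (a *: x + y) z = a * B x z + B y z) ->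
  (forall x y, B x y = B y x) -> (forall x, 0 <= B x x) ->
  forall x y, B x x = 0 -> B x y = 0.
Proof.
move=> Bl Bs B0 x y xx; apply/eqP/negPn/negP => xy0.
(* With this [t] the form takes the value -1 at [t *: x + y]. *)
pose t := - (B y y + 1) / (2 * B x y).
have e : B (t *: x + y) (t *: x + y) = 2 * (t * B x y) + B y y.
  rewrite Bl (Bs x (t *: x + y)) (Bs y (t *: x + y)) !Bl xx mulr0 add0r (Bs y x).
  by rewrite addrA -mulr2n mulr_natl.
have tE : 2 * (t * B x y) = - (B y y + 1).
  by rewrite mulrCA mulfVK // mulf_neq0 ?pnatr_eq0.
have := B0 (t *: x + y); rewrite e tE opprD addrAC addNr add0r.
by rewrite ler0N1.
Qed.

(** A representative is asserted to exist, not to be unique: the generators may be dependent and [B]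
    degenerate, as for polynomials on a face. Definiteness is replaced by the condition that [l]
    vanishes on isotropic combinations. *)
Lemma riesz_fin (E : lmodType R) (I : finType) (g : I -> E)
    (B : E -> E -> R) (l : E -> R) :
  (forall a x y z, B (a *: x + y) z = a * B x z + B y z) ->
  (forall x y, B x y = B y x) ->
  (forall a x y, l (a *: x + y) = a * l x + l y) ->
  (forall c : I -> R, let x := \sum_i c i *: g i in B x x = 0 -> l x = 0) ->
  exists c : I -> R, forall e : I -> R,
    B (\sum_i c i *: g i) (\sum_i e i *: g i) = l (\sum_i e i *: g i).
Proof.
move=> Bl Bs ll Bl0.
have B0 z : B 0 z = 0.
  by apply: (@addrI _ (B 0 z)); have := Bl 1 0 0 z; rewrite scale1r !addr0 mul1r.
have l0 : l 0 = 0.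
  by apply: (@addrI _ (l 0)); have := ll 1 0 0; rewrite scale1r !addr0 mul1r.
have BS (c : I -> R) z : B (\sum_i c i *: g i) z = \sum_i c i * B (g i) z.
  by elim/big_rec2: _ => [|i y1 y2 _ <-]; rewrite ?B0 ?Bl.
have lS (c : I -> R) : l (\sum_i c i *: g i) = \sum_i c i * l (g i).
  by elim/big_rec2: _ => [|i y1 y2 _ <-]; rewrite ?l0 ?ll.
have BSr (c : I -> R) z : B z (\sum_i c i *: g i) = \sum_i c i * B z (g i).
  by rewrite Bs BS; apply: eq_bigr => i _; rewrite Bs.
pose f (i : 'I_#|I|) := g (enum_val i).
have reI (V : zmodType) (F : I -> V) : \sum_i F i = \sum_(k < #|I|) F (enum_val k).
  by rewrite (reindex _ (onW_bij _ (@enum_val_bij I))).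
pose G := \matrix_(i, j) B (f i) (f j).
pose L := \col_i l (f i).
have [||c Gc] := @sym_solvable _ G L.
- by apply/matrixP => i j; rewrite !mxE Bs.
- move=> c cGc.
  pose e i := c (enum_rank i) 0.
  have := Bl0 e; rewrite /= lS BS !reI => H.
  have eE k : e (enum_val k) = c k 0 by rewrite /e enum_valK.
  apply/matrixP => i j; rewrite !ord1 !mxE.
  rewrite -[RHS]H.
    by apply: eq_bigr => k _; rewrite !mxE eE.
  have := congr1 (fun M : 'M[R]_1 => M 0 0) cGc.
  rewrite -mulmxA mxE [in X in _ = X -> _]mxE => E0; rewrite -[RHS]E0.
  apply: eq_bigr => k _; 
  rewrite -(reI _ (fun i => e i *: g i)) BSr reI !mxE eE; congr (_ * _).
  by apply: eq_bigr => k' _; rewrite !mxE eE mulrC.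
exists (fun i => c (enum_rank i) 0) => e.
rewrite BSr lS !reI; apply: eq_bigr => k _; congr (_ * _).
rewrite -(reI _ (fun i => c (enum_rank i) 0 *: g i)) BS reI.
have := congr1 (fun M : 'cV[R]_#|I| => M k 0) Gc; rewrite !mxE => <-.
by apply: eq_bigr => k' _; rewrite !mxE enum_valK mulrC Bs.
Qed.

End Riesz.

(** * Induction, derivatives and degrees of multivariate polynomials *)

Section PolyTools.
Context {R : realType} {n : nat}.
Implicit Types (p q : mpoly n R) (c a : R) (i : 'I_n).
Local Notation X i := (mpolyX R (mnm1 i)).

Lemma mpoly_alg_ind (Q : mpoly n R -> Prop) :
  (forall c, Q (mpolyC n c)) -> (forall i, Q (X i)) ->
  (forall p q, Q p -> Q q -> Q (p + q)) ->
  (forall p q, Q p -> Q q -> Q (p * q)) -> forall p, Q p.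
Proof.
move=> QC QX QD QM.
have Q1 : Q 1 by have := QC 1.
elim/mpolyind => [|c m p _ _ Qp]; first by have := QC 0; rewrite mpolyC0.
apply: (QD) => //; rewrite -mul_mpolyC; apply: (QM) => //.
rewrite mpolyXE_id; elim/big_ind: _ => // i _.
by elim: (m i) => [|k IH] //; rewrite exprS; apply: (QM).
Qed.

Lemma mderivXU i k : mderiv i (X k) = (i == k)%:R.
Proof.
rewrite mderivX mnm1E eq_sym; case: eqP => [->|_]; last by rewrite scale0r.
rewrite scale1r; have -> : mnm_sub (mnm1 k) (mnm1 k) = mnm0 :> multinom n.
  by apply/mnmP => l; rewrite mnmBE mnm0E subnn.
exact: mpolyX0.
Qed.

Lemma deg_leP (j : nat) p :
  deg_le j p <-> forall m, (j < mdeg m)%N -> mcoeff m p = 0.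
Proof.
split=> [pj m jm|H].
  by apply/memN_msupp_eq0/msize_mdeg_ge/(leq_trans pj).
rewrite /deg_le msizeE big_seq_cond; elim/big_ind: _ => // [x y hx hy|m].
  by rewrite geq_max hx hy.
rewrite andbT => mp; rewrite ltnS leqNgt; apply/negP => jm.
by move: mp; rewrite mcoeff_msupp H // eqxx.
Qed.

End PolyTools.

(** * Barycentric integrals *)

Section BaryIntegral.
Context {R : realType} {V : finType}.
Implicit Types (S : {set V}) (P Q : mpoly #|V| R).

(* Barycentric coordinates of the point of parameter t in hull S, in the
   enumeration of S used by [vertex]; the default of [nth] makes them 0 outside
   S. *)
Definition bary S (t : 'rV[R]_(#|S|.-1)) (v : V) : R :=
  nth 0 ((1 - \sum_i t 0 i) :: codom (fun i => t 0 i)) (index v (enum S)).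

Definition beval S (t : 'rV[R]_(#|S|.-1)) P : R :=
  meval (fun i => bary t (enum_val i)) P.

(** There is one variable for every vertex of the mesh, evaluated to 0 outside [S]; restricting an
    integrand to a facet therefore leaves the polynomial unchanged. *)
Definition bint S P : R := corner_int 1 (fun t : 'rV[R]_(#|S|.-1) => beval t P).

Definition supported S (a : V -> nat) : bool :=
  [forall v, (0 < a v)%N ==> (v \in S)].

(** Dirichlet's value for the barycentric monomial with exponents [a], without the Jacobian. *)
Definition bweight S (a : V -> nat) : R :=
  if supported S a
  then (\prod_(v in S) (a v)`!)%:R / ((\sum_(v in S) a v + #|S|.-1)`!)%:R
  else 0.

Definition expo (m : multinom #|V|) (v : V) : nat := m (enum_rank v).

Lemma big_enum_nth (T : Type) (idx : T) (op : Monoid.com_law idx) S (v0 : V)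
    (F : V -> T) :
  \big[op/idx]_(v in S) F v = \big[op/idx]_(i < #|S|) F (nth v0 (enum S) i).
Proof. by rewrite -big_enum (big_nth v0) big_mkord cardE. Qed.

Lemma bary0 S (t : 'rV[R]_(#|S|.-1)) v0 :
  (0 < #|S|)%N -> bary t (nth v0 (enum S) 0) = 1 - \sum_i t 0 i.
Proof.
by move=> S0; rewrite /bary index_uniq ?enum_uniq // -cardE.
Qed.

Lemma baryS S (t : 'rV[R]_(#|S|.-1)) v0 (i : 'I_(#|S|.-1)) :
  bary t (nth v0 (enum S) i.+1) = t 0 i.
Proof.
have iS : (i.+1 < #|S|)%N by rewrite -ltn_predRL.
rewrite /bary index_uniq ?enum_uniq -?cardE //=.
by rewrite (nth_map i) ?size_enum_ord // nth_ord_enum.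
Qed.

Lemma bary_out S (t : 'rV[R]_(#|S|.-1)) v :
  (0 < #|S|)%N -> v \notin S -> bary t v = 0.
Proof.
move=> S0 vS; rewrite /bary nth_default //= size_codom card_ord prednK //.
by rewrite cardE leqNgt index_mem mem_enum.
Qed.

Lemma big_bary (T : Type) (idx : T) (op : Monoid.com_law idx) S (v0 : V)
    (F : V -> T) : (0 < #|S|)%N ->
  \big[op/idx]_(v in S) F v = op (F (nth v0 (enum S) 0))
    (\big[op/idx]_(i < #|S|.-1) F (nth v0 (enum S) i.+1)).
Proof.
move=> S0; rewrite (big_enum_nth _ _ v0).
by rewrite -[in LHS](prednK S0) big_ord_recl.
Qed.

Lemma bary_sum S (t : 'rV[R]_(#|S|.-1)) :
  (0 < #|S|)%N -> \sum_(v in S) bary t v = 1.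
Proof.
move=> S0; have /card_gt0P [v0 _] := S0.
rewrite (big_bary _ v0) //= bary0 // (eq_bigr (fun i => t 0 i)) => [|i _].
  by rewrite subrK.
exact: baryS.
Qed.

Lemma bary_ge0 S (t : 'rV[R]_(#|S|.-1)) v : (0 < #|S|)%N ->
  (forall i, 0 <= t 0 i) -> \sum_i t 0 i <= 1 -> 0 <= bary t v.
Proof.
move=> S0 t0 t1; have [vS|vS] := boolP (v \in S); last by rewrite bary_out.
rewrite /bary; case: (index _ _) => [|i] /=; first by rewrite subr_ge0.
have [im|im] := ltnP i #|S|.-1.
  by rewrite (nth_map (Ordinal im)) ?size_enum_ord.
by rewrite nth_default // size_codom card_ord.
Qed.

Lemma reindex_enum_val (T : Type) (idx : T) (op : Monoid.com_law idx)
    (F : V -> T) :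
  \big[op/idx]_(i < #|V|) F (enum_val i) = \big[op/idx]_v F v.
Proof. by rewrite (reindex _ (onW_bij _ (@enum_val_bij V))). Qed.

Lemma bary_prod S (t : 'rV[R]_(#|S|.-1)) v0 (a : V -> nat) : (0 < #|S|)%N ->
  \prod_v bary t v ^+ a v = if supported S a then
    \prod_(i < #|S|.-1) t 0 i ^+ a (nth v0 (enum S) i.+1)
    * (1 - \sum_i t 0 i) ^+ a (nth v0 (enum S) 0) else 0.
Proof.
move=> S0; case: ifPn => [/forallP aS|].
  rewrite (bigID (mem S)) /= [X in _ * X]big1 => [|v vS]; last first.
    by have := aS v; rewrite (negbTE vS) implybF -eqn0Ngt => /eqP ->.
  rewrite mulr1 (big_bary _ v0) //= bary0 // mulrC; congr (_ * _).
  by apply: eq_bigr => i _; rewrite baryS.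
rewrite negb_forall => /existsP [v]; rewrite negb_imply => /andP[av vS].
by rewrite (bigD1 v) //= bary_out // expr0n eqn0Ngt av mul0r.
Qed.

(** The degree bound is free so that several polynomials can be expanded over one index set;
    linearity of [bint] follows from this. *)
Lemma bintE S (k : nat) P : (0 < #|S|)%N -> (mmeasure mdeg P <= k)%N ->
  bint S P = \sum_(m : bmultinom #|V| k) mcoeff m P * bweight S (expo m).
Proof.
move=> S0 Pk; have /card_gt0P [v0 _] := S0.
pose a (m : bmultinom #|V| k) i := expo m (nth v0 (enum S) i).
pose c (m : bmultinom #|V| k) : R :=
  if supported S (expo m) then mcoeff m P else 0.
transitivity (corner_int 1 (fun t : 'rV_(#|S|.-1) => \sum_(m : bmultinom #|V| k)
    c m * (\prod_i t 0 i ^+ a m i.+1 * (1 - \sum_i t 0 i) ^+ a m 0%N))).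
  congr (corner_int _ _); apply/funext => t.
  rewrite /beval {1}(mpolywE Pk) raddf_sum /=; apply: eq_bigr => m _.
  rewrite mevalZ mevalX /c.
  have -> : \prod_(i < #|V|) bary t (enum_val i) ^+ m i
      = \prod_v bary t v ^+ expo m v.
    rewrite -reindex_enum_val; apply: eq_bigr => i _.
    by rewrite /expo enum_valK.
  by rewrite (bary_prod _ v0) //; case: ifP; rewrite ?mulr0 ?mul0r.
rewrite corner_int_sum //; apply: eq_bigr => m _.
rewrite expr1n mulr1 /c /bweight; case: ifP => _; last by rewrite !mul0r mulr0.
rewrite -mulrA; congr (_ * _); rewrite !(big_bary _ v0) //=.
by rewrite mulnC (addnC (\sum_(i < _) a m i.+1)%N).
Qed.

Lemma bint_linear S a P Q : (0 < #|S|)%N ->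
  bint S (a *: P + Q) = a * bint S P + bint S Q.
Proof.
move=> S0; pose k := maxn (mmeasure mdeg (a *: P + Q))
  (maxn (mmeasure mdeg P) (mmeasure mdeg Q)).
rewrite !(@bintE _ k) // ?leq_max ?leqnn ?orbT //.
rewrite mulr_sumr -big_split /=; apply: eq_bigr => m _.
by rewrite mcoeffD mcoeffZ mulrDl mulrA.
Qed.

Lemma bint0 S : (0 < #|S|)%N -> bint S 0 = 0.
Proof.
move=> S0; apply: (@addrI _ (bint S 0)).
by have := bint_linear 1 0 0 S0; rewrite scale1r !addr0 mul1r.
Qed.

Lemma bintD S P Q : (0 < #|S|)%N -> bint S (P + Q) = bint S P + bint S Q.
Proof. by move=> S0; have := bint_linear 1 P Q S0; rewrite scale1r mul1r. Qed.

Lemma bintZ S a P : (0 < #|S|)%N -> bint S (a *: P) = a * bint S P.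
Proof.
by move=> S0; have := bint_linear a P 0 S0; rewrite addr0 bint0 // addr0.
Qed.

Lemma bint_sum S (I : Type) (r : seq I) (A : pred I) (F : I -> mpoly #|V| R) :
  (0 < #|S|)%N ->
  bint S (\sum_(i <- r | A i) F i) = \sum_(i <- r | A i) bint S (F i).
Proof.
move=> S0; elim/big_rec2: _ => [|i y1 y2 _ <-]; first exact: bint0.
exact: bintD.
Qed.

Lemma bint_mono S (m : multinom #|V|) : (0 < #|S|)%N ->
  bint S (mpolyX R m) = bweight S (expo m).
Proof.
move=> S0; rewrite (@bintE _ (mdeg m).+1) // ?msizeX //.
rewrite (bigD1 (BMultinom (leqnn (mdeg m).+1))) //= big1 ?addr0 => [|m' mm'].
  by rewrite mcoeffX eqxx mul1r.
by rewrite mcoeffX (_ : m == m' = false) ?mul0r // eq_sym; apply/negbTE.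
Qed.

Lemma eq_bint S P Q : (0 < #|S|)%N ->
  (forall c : V -> R, (forall v, v \in S -> 0 <= c v) ->
     (forall v, v \notin S -> c v = 0) -> \sum_(v in S) c v = 1 ->
     meval (fun i => c (enum_val i)) P = meval (fun i => c (enum_val i)) Q) ->
  bint S P = bint S Q.
Proof.
move=> S0 PQ; apply: eq_corner_int => // t t0 t1; apply: PQ.
- by move=> v _; apply: bary_ge0.
- by move=> v; apply: bary_out.
- exact: bary_sum.
Qed.

Lemma bint_vanish S v P Q : (0 < #|S|)%N -> v \notin S ->
  P = mpolyX R (mnm1 (enum_rank v)) * Q -> bint S P = 0.
Proof.
move=> S0 vS ->; rewrite -(bint0 S0); apply: eq_bint => // c _ c0 _.
by rewrite mevalM mevalXU enum_rankK c0 // mul0r meval0.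
Qed.

Lemma bint_sqr_ge0 S P : 0 <= bint S (P * P).
Proof. by apply: corner_int_ge0 => t; rewrite /beval mevalM -expr2 sqr_ge0. Qed.

(** The point is that the right-hand side does not depend on [v]. If [a v = 0] only the facet term
    survives, otherwise only the derivative term; lowering an exponent and lowering the dimension
    lead to the same factorial. *)
Lemma bweight_split S v (a b : V -> nat) : (1 < #|S|)%N -> v \in S ->
  supported S a -> (forall w, b w = (a w - (w == v))%N) ->
  (a v)%:R * bweight S b + bweight (S :\ v) a =
  (\prod_(v in S) (a v)`!)%:R / ((\sum_(v in S) a v + #|S|.-2)`!)%:R.
Proof.
move=> S1 vS aS ab.
have cS : #|S|.-1 = #|S|.-2.+1 by case: #|S| S1 => [|[]].
have cSv : #|S :\ v| = #|S|.-1 by rewrite (cardsD1 v S) vS.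
have bS : supported S b.
  apply/forallP => w; apply/implyP => bw; move/forallP/(_ w)/implyP: aS; apply.
  by apply: leq_trans bw _; rewrite ab leq_subr.
have prodD (F : V -> nat) : (\prod_(w in S) F w = F v * \prod_(w in S :\ v) F w)%N.
  by rewrite (big_setD1 v).
have sumD (F : V -> nat) : (\sum_(w in S) F w = F v + \sum_(w in S :\ v) F w)%N.
  by rewrite (big_setD1 v).
have bE w : w \in S :\ v -> b w = a w.
  by rewrite !inE => /andP[wv _]; rewrite ab (negbTE wv) subn0.
have pb : (\prod_(w in S :\ v) (b w)`! = \prod_(w in S :\ v) (a w)`!)%N.
  by apply: eq_bigr => w /bE ->.
have sb : (\sum_(w in S :\ v) b w = \sum_(w in S :\ v) a w)%N.
  by apply: eq_bigr => w /bE ->.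
have bv : b v = (a v).-1 by rewrite ab eqxx subn1.
rewrite {1}/bweight bS !prodD !sumD pb sb bv.
case: (posnP (a v)) => [av|av].
  rewrite av mul0r add0r /bweight.
  have -> : supported (S :\ v) a.
    apply/forallP => w; apply/implyP => aw; rewrite !inE.
    move/forallP/(_ w)/implyP: aS => -> //; rewrite andbT.
    by apply: contraTneq aw => ->; rewrite av.
  by rewrite fact0 mul1n add0n cSv.
have -> : bweight (S :\ v) a = 0.
  rewrite /bweight; case: ifP => // /forallP /(_ v).
  by rewrite av !inE eqxx.
rewrite addr0 mulrA -natrM mulnA; congr ((_ * _)%:R / (_`!)%:R).
  by case: (a v) av.
by rewrite cS addnS -addSn -addSn prednK.
Qed.

(** The divergence theorem in barycentric form. On each monomial [bweight_split] makes the two sides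
    differ by a constant times the sum of [c], which is zero for a tangential direction. *)
Lemma bint_div S (c : V -> R) P : (1 < #|S|)%N ->
  (forall v, v \notin S -> c v = 0) -> \sum_(v in S) c v = 0 ->
  bint S (\sum_v c v *: mderiv (enum_rank v) P) =
  - \sum_(v in S) c v * bint (S :\ v) P.
Proof.
move=> S1 cS c0.
have S0 : (0 < #|S|)%N by apply: ltnW.
have Sv0 v : v \in S -> (0 < #|S :\ v|)%N.
  by move=> vS; move: S1; rewrite (cardsD1 v S) vS ltnS.
elim/mpolyind: P => [|a m P _ _ IH].
  rewrite big1 => [|v _]; last by rewrite mderiv0 scaler0.
  rewrite bint0 // big1 ?oppr0 // => v vS.
  by rewrite bint0 ?mulr0 // Sv0.
have -> : \sum_v c v *: mderiv (enum_rank v) (a *: mpolyX R m + P) =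
    a *: (\sum_v c v *: mderiv (enum_rank v) (mpolyX R m)) +
    \sum_v c v *: mderiv (enum_rank v) P.
  rewrite scaler_sumr -big_split /=; apply: eq_bigr => v _.
  by rewrite linearP scalerDr !scalerA mulrC.
rewrite bint_linear // IH.
have -> : \sum_(v in S) c v * bint (S :\ v) (a *: mpolyX R m + P) =
    a * (\sum_(v in S) c v * bint (S :\ v) (mpolyX R m)) +
    \sum_(v in S) c v * bint (S :\ v) P.
  rewrite mulr_sumr -big_split /=; apply: eq_bigr => v vS.
  by rewrite bint_linear ?Sv0 // mulrDr !mulrA [c v * a]mulrC.
rewrite opprD -mulrN; congr (a * _ + _).
apply/eqP; rewrite -addr_eq0; apply/eqP.
rewrite bint_sum // [X in X + _](bigID (mem S)) /=.
rewrite [X in _ + X + _]big1 => [|v vS]; last first.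
  by rewrite cS // scale0r bint0.
rewrite addr0 -big_split /=.
pose a' := expo m.
transitivity (\sum_(v in S) c v * ((a' v)%:R *
    bweight S (expo (mnm_sub m (mnm1 (enum_rank v)))) + bweight (S :\ v) a')).
  apply: eq_bigr => v vS; rewrite mderivX !bintZ // !bint_mono ?Sv0 //.
  by rewrite mulrDr.
have [aS|aS] := boolP (supported S a').
  transitivity (\sum_(v in S) c v * ((\prod_(v in S) (a' v)`!)%:R /
    ((\sum_(v in S) a' v + #|S|.-2)`!)%:R)).
    apply: eq_bigr => v vS; congr (_ * _); apply: bweight_split => // w.
    by rewrite /expo mnmBE mnm1E (inj_eq enum_rank_inj) eq_sym.
  by rewrite -mulr_suml c0 mul0r.
(* A variable [w] from outside [S] survives both differentiation along [S] and restriction to a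
   facet, so every term is zero. *)
move: aS; rewrite negb_forall => /existsP [w]; rewrite negb_imply => /andP[aw wS].
apply: big1 => v vS; rewrite /bweight; case: ifP => [/forallP/(_ w)|_].
  rewrite /expo mnmBE mnm1E (inj_eq enum_rank_inj).
  have -> : v == w = false by apply/negP => /eqP e; rewrite e (negbTE wS) in vS.
  by rewrite subn0 -/(expo m w) -/a' aw (negbTE wS).
case: ifP => [/forallP/(_ w)|_]; last by rewrite mulr0 addr0 mulr0.
by rewrite aw !inE (negbTE wS) andbF.
Qed.

End BaryIntegral.

(** * Polynomials and affine functions on a simplex *)

Section Simplex.
Context {R : realType} {d : nat} {V : finType}.
Variable pos : V -> 'rV[R]_d.
Local Notation poly := (mpoly d R).
Local Notation vec := 'rV[R]_d.
Implicit Types (S F T : {set V}) (p q : poly) (c : V -> R) (a n : vec).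

(** Pull-back along the map from barycentric coordinates to points. It involves all vertices of the
    mesh, so a simplex and its facets share the same lift. *)
Definition lift_poly p : mpoly #|V| R :=
  comp_mpoly [tuple \sum_(i < #|V|) pos (enum_val i) 0 k *: mpolyX R (mnm1 i)
             | k < d] p.

Lemma lift_polyD p q : lift_poly (p + q) = lift_poly p + lift_poly q.
Proof. exact: comp_mpolyD. Qed.

Lemma lift_polyZ (b : R) p : lift_poly (b *: p) = b *: lift_poly p.
Proof. exact: comp_mpolyZ. Qed.

Lemma lift_polyM p q : lift_poly (p * q) = lift_poly p * lift_poly q.
Proof. exact: rmorphM. Qed.

Lemma lift_poly0 : lift_poly 0 = 0.
Proof. exact: comp_mpoly0. Qed.

Lemma lift_poly_sum (I : Type) (r : seq I) (P : pred I) (G : I -> poly) :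
  lift_poly (\sum_(i <- r | P i) G i) = \sum_(i <- r | P i) lift_poly (G i).
Proof.
by elim/big_rec2: _ => [|i y1 y2 _ <-]; rewrite ?lift_poly0 ?lift_polyD.
Qed.

Lemma meval_lift_poly c p :
  meval (fun i => c (enum_val i)) (lift_poly p) = ev p (\sum_v c v *: pos v).
Proof.
rewrite comp_mpoly_meval /ev; apply: meval_eq => k.
rewrite tnth_mktuple raddf_sum /= summxE -[RHS]reindex_enum_val /=.
by apply: eq_bigr => i _; rewrite mevalZ mevalXU mxE mulrC.
Qed.

Lemma mderiv_lift_poly i p : mderiv i (lift_poly p) =
  \sum_k pos (enum_val i) 0 k *: lift_poly (mderiv k p).
Proof.
move: p; apply: mpoly_alg_ind => [b|k|p q IHp IHq|p q IHp IHq].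
- rewrite /lift_poly comp_mpolyC mderivC big1 // => k _.
  by rewrite mderivC comp_mpoly0 scaler0.
- rewrite {1}/lift_poly comp_mpolyXU (_ : [tuple _ | _ < _]`_k = tnth
    [tuple \sum_(i < #|V|) pos (enum_val i) 0 k *: mpolyX R (mnm1 i) | k < d] k);
    last by rewrite -tnth_nth.
  rewrite tnth_mktuple raddf_sum /= (bigD1 i) //= big1 => [|j ji].
    rewrite (bigD1 k) //= big1 => [|j jk].
      by rewrite mderivZ !mderivXU !eqxx /lift_poly -mpolyC1 comp_mpolyC.
    by rewrite mderivXU (negbTE jk) lift_poly0 scaler0.
  by rewrite mderivZ mderivXU eq_sym (negbTE ji) scaler0.
- rewrite lift_polyD mderivD IHp IHq -big_split /=; apply: eq_bigr => k _.
  by rewrite mderivD lift_polyD scalerDr.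
- rewrite lift_polyM mderivM IHp IHq mulr_suml mulr_sumr -big_split /=.
  apply: eq_bigr => k _.
  by rewrite mderivM lift_polyD !lift_polyM scalerDr -scalerAl -scalerAr.
Qed.

Lemma dirder_lift_poly c p :
  \sum_v c v *: mderiv (enum_rank v) (lift_poly p) =
  lift_poly (dirder (\sum_v c v *: pos v) p).
Proof.
rewrite /dirder lift_poly_sum.
transitivity (\sum_v \sum_k (c v * pos v 0 k) *: lift_poly (mderiv k p)).
  apply: eq_bigr => v _; rewrite mderiv_lift_poly scaler_sumr enum_rankK.
  by apply: eq_bigr => k _; rewrite scalerA.
rewrite exchange_big; apply: eq_bigr => k _ /=.
rewrite lift_polyZ summxE -scaler_suml; congr (_ *: _).
by apply: eq_bigr => v _; rewrite mxE.
Qed.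

Lemma vertexE S v0 i : (i < #|S|)%N -> vertex pos S i = pos (nth v0 (enum S) i).
Proof. by move=> iS; rewrite /vertex (nth_map v0) // -cardE. Qed.

Lemma sum_zero_out (W : lmodType R) S c (G : V -> W) :
  (forall v, v \notin S -> c v = 0) ->
  \sum_v c v *: G v = \sum_(v in S) c v *: G v.
Proof.
move=> cS; rewrite [RHS]big_mkcond; apply: eq_bigr => v _ /=.
by case: ifPn => // /cS ->; rewrite scale0r.
Qed.

Lemma param_bary S (t : 'rV[R]_(#|S|.-1)) : (0 < #|S|)%N ->
  vertex pos S 0 + t *m edges pos S = \sum_v bary t v *: pos v.
Proof.
move=> S0; have /card_gt0P [v0 _] := S0.
rewrite (sum_zero_out (S := S)) => [|v]; last exact: bary_out.
rewrite (big_bary _ v0) //= bary0 // -vertexE // scalerBl scale1r.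
rewrite mulmx_sum_row scaler_suml -addrA; congr (_ + _).
rewrite addrC -sumrB; apply: eq_bigr => i _; rewrite baryS rowK scalerBr.
by rewrite -vertexE // -ltn_predRL.
Qed.

Definition jac S : R := Num.sqrt (\det (edges pos S *m (edges pos S)^T)).

Definition pint S p : R := simplex_int pos S (ev p).

Lemma pintE S p : (0 < #|S|)%N -> pint S p = jac S * bint S (lift_poly p).
Proof.
move=> S0; congr (_ * corner_int _ _); apply/funext => t.
by rewrite param_bary // -meval_lift_poly.
Qed.

Lemma ipE S p q : ip pos S (ev p) (ev q) = pint S (p * q).
Proof.
by congr (_ * corner_int _ _); apply/funext => t; rewrite /ev mevalM.
Qed.

Lemma pint_linear S b p q : (0 < #|S|)%N ->
  pint S (b *: p + q) = b * pint S p + pint S q.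
Proof.
move=> S0; rewrite !pintE // lift_polyD lift_polyZ bint_linear // mulrDr.
by rewrite mulrCA.
Qed.

Lemma pintD S p q : (0 < #|S|)%N -> pint S (p + q) = pint S p + pint S q.
Proof. by move=> S0; have := pint_linear 1 p q S0; rewrite scale1r mul1r. Qed.

Lemma pint0 S : (0 < #|S|)%N -> pint S 0 = 0.
Proof. by move=> S0; rewrite pintE // lift_poly0 bint0 // mulr0. Qed.

Lemma pintZ S b p : (0 < #|S|)%N -> pint S (b *: p) = b * pint S p.
Proof.
by move=> S0; have := pint_linear b p 0 S0; rewrite !addr0 pint0 // addr0.
Qed.

Lemma pintN S p : (0 < #|S|)%N -> pint S (- p) = - pint S p.
Proof. by move=> S0; rewrite -scaleN1r pintZ // mulN1r. Qed.

Lemma pintB S p q : (0 < #|S|)%N -> pint S (p - q) = pint S p - pint S q.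
Proof. by move=> S0; rewrite pintD // pintN. Qed.

Lemma pint_sum S (I : Type) (r : seq I) (P : pred I) (G : I -> poly) :
  (0 < #|S|)%N ->
  pint S (\sum_(i <- r | P i) G i) = \sum_(i <- r | P i) pint S (G i).
Proof.
move=> S0; elim/big_rec2: _ => [|i y1 y2 _ <-]; first exact: pint0.
exact: pintD.
Qed.

Lemma pint_sqr_ge0 S p : (0 < #|S|)%N -> 0 <= pint S (p * p).
Proof.
move=> S0; rewrite pintE // lift_polyM mulr_ge0 ?sqrtr_ge0 //.
exact: bint_sqr_ge0.
Qed.

Lemma eq_simplex_int S (f g : vec -> R) : (0 < #|S|)%N ->
  (forall x, hull pos S x -> f x = g x) ->
  simplex_int pos S f = simplex_int pos S g.
Proof.
move=> S0 fg; congr (_ * _); apply: eq_corner_int => // t t0 t1; apply: fg.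
rewrite param_bary //; exists (bary t); split.
- by move=> v _; apply: bary_ge0.
- exact: bary_sum.
- by apply: sum_zero_out => v; apply: bary_out.
Qed.

(** Deleting [v] from the enumeration of [S] shifts the later positions by one, which is what [bump]
    expresses. *)
Lemma vertex_setD1 S v i : v \in S -> (i.+1 < #|S|)%N ->
  vertex pos (S :\ v) i = vertex pos S (bump (index v (enum S)) i).
Proof.
move=> vS iS.
have eD : enum (S :\ v) = rem v (enum S).
  rewrite rem_filter ?enum_uniq // /enum_mem -filter_predI.
  by apply: eq_filter => w; rewrite /= !inE.
have cS : #|S| = #|S :\ v|.+1 by rewrite (cardsD1 v S) vS.
have vs : (index v (enum S) < size (enum S))%N by rewrite index_mem mem_enum.
rewrite (vertexE v) ?eD; last by rewrite -ltnS -cS.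
rewrite (vertexE v); last first.
  by apply: leq_ltn_trans iS; rewrite /bump -add1n leq_add2r leq_b1.
congr pos; rewrite remE nth_cat size_take vs.
rewrite /bump; case: ltnP => ji; last by rewrite nth_drop addSn subnKC.
by rewrite nth_take.
Qed.

Lemma sum_mask S F c : F \subset S ->
  \sum_(v in S) (if v \in F then c v else 0) = \sum_(v in F) c v.
Proof.
move=> FS; rewrite (big_setID F) /= (finset.setIidPr FS).
rewrite [Z in _ + Z]big1 ?addr0 => [|v]; first by apply: eq_bigr => v ->.
by rewrite inE => /andP[/negbTE ->].
Qed.

Lemma sum_scale_mask (W : lmodType R) S F c (G : V -> W) : F \subset S ->
  \sum_(v in S) (if v \in F then c v else 0) *: G v =
  \sum_(v in F) c v *: G v.
Proof.
move=> FS; rewrite (big_setID F) /= (finset.setIidPr FS).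
rewrite [Z in _ + Z]big1 ?addr0 => [|v]; first by apply: eq_bigr => v ->.
by rewrite inE => /andP[/negbTE -> _]; rewrite scale0r.
Qed.

Lemma affinely_independentW S F :
  F \subset S -> affinely_independent pos S -> affinely_independent pos F.
Proof.
move=> FS indS c c0 cp v vF.
have := indS (fun w => if w \in F then c w else 0).
rewrite sum_mask // sum_scale_mask // => /(_ c0 cp v (fintype.subsetP FS _ vF)).
by rewrite vF.
Qed.

(* Affine functions on hull S have a gradient in the tangent space of S. *)
Lemma riesz_simplex S (f : V -> R) : affinely_independent pos S ->
  exists c, [/\ forall v, v \notin S -> c v = 0, \sum_(v in S) c v = 0 &
    forall p q : V, p \in S -> q \in S ->
      dotv (\sum_(v in S) c v *: pos v) (pos p - pos q) = f p - f q].
Proof.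
move=> indS; have [->|[v0 v0S]] := set_0Vmem S.
  by exists (fun=> 0); split=> // [|p q]; rewrite ?big_set0 ?inE.
(* Measuring positions from [v0] turns arbitrary coefficients into coefficients of sum zero. *)
have shift (W : lmodType R) (c : V -> R) (G : V -> W) :
    \sum_(v in S) c v *: (G v - G v0) =
    \sum_(v in S) (c v - (v == v0)%:R * \sum_(w in S) c w) *: G v.
  under eq_bigr do rewrite scalerBr; under [RHS]eq_bigr do rewrite scalerBl.
  rewrite !sumrB; congr (_ - _).
  rewrite [RHS](bigD1 v0) //= [X in _ = _ + X]big1 => [|v /andP[_ /negbTE->]].
    by rewrite eqxx mul1r addr0 scaler_suml.
  by rewrite mul0r scale0r.
pose g v := if v \in S then pos v - pos v0 else 0.
pose fl v := if v \in S then f v - f v0 else 0.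
pose A : 'M[R]_(#|V|, d) := \matrix_i g (enum_val i).
pose l : 'cV[R]_#|V| := \col_i fl (enum_val i).
have [||c Gc] := @sym_solvable R #|V| (A *m A^T) l.
- by rewrite trmx_mul trmxK.
(* An isotropic vector gives a vanishing combination of the edges at [v0]; affine independence kills
   its coefficients away from [v0], and [fl] is zero at [v0]. *)
- move=> c cAAc.
  pose e v := c (enum_rank v) 0.
  have eE i : e (enum_val i) = c i 0 by rewrite /e enum_valK.
  have cA : c^T *m A = \sum_(v in S) e v *: (pos v - pos v0).
    rewrite mulmx_sum_row; transitivity (\sum_v e v *: g v).
      rewrite -[in X in _ = X]reindex_enum_val; apply: eq_bigr => i _.
      by rewrite rowK eE mxE.
    rewrite [RHS]big_mkcond; apply: eq_bigr => v _ /=.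
    by rewrite /g; case: ifP; rewrite ?scaler0.
  have : c^T *m A = 0.
    apply: dotv_eq0; rewrite dotvE trmx_mul trmxK !mulmxA.
    by rewrite -(mulmxA c^T) cAAc mxE.
  rewrite cA shift => e0.
  have es : \sum_(v in S) (e v - (v == v0)%:R * \sum_(w in S) e w) = 0.
    rewrite sumrB (bigD1 v0) //= [X in _ - X](bigD1 v0) //=.
    rewrite [X in _ - (_ + X)]big1 => [|v /andP[_ /negbTE->]].
      by rewrite eqxx mul1r addr0 -(bigD1 v0 v0S) /= subrr.
    by rewrite mul0r.
  have ev0 v : v \in S -> v != v0 -> e v = 0.
    move=> vS vv0; have := indS _ es e0 v vS.
    by rewrite (negbTE vv0) mul0r subr0.
  apply/matrixP => i j; rewrite !ord1 mxE [RHS]mxE.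
  transitivity (\sum_v e v * fl v).
    rewrite -[in X in _ = X]reindex_enum_val; apply: eq_bigr => k _.
    by rewrite !mxE eE.
  apply: big1 => v _; rewrite /fl; case: ifP => vS; last by rewrite mulr0.
  have [->|vv0] := eqVneq v v0; first by rewrite subrr mulr0.
  by rewrite ev0 // mul0r.
pose e v := c (enum_rank v) 0.
have eE i : e (enum_val i) = c i 0 by rewrite /e enum_valK.
pose e' v := if v \in S then e v - (v == v0)%:R * \sum_(w in S) e w else 0.
have e'E (W : lmodType R) (G : V -> W) :
    \sum_(v in S) e' v *: G v = \sum_(v in S) e v *: (G v - G v0).
  by rewrite shift; apply: eq_bigr => v vS; rewrite /e' vS.
exists e'; split.
- by move=> v vS; rewrite /e' (negbTE vS).
- have := e'E R^o (fun=> 1); rewrite /GRing.scale /=.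
  rewrite -mulr_suml mulr1 => ->.
  by apply: big1 => v _; rewrite subrr mulr0.
have key (p : V) : p \in S ->
    dotv (\sum_(v in S) e' v *: pos v) (pos p - pos v0) = f p - f v0.
  move=> pS; rewrite e'E.
  have := congr1 (fun M : 'cV[R]_#|V| => M (enum_rank p) 0) Gc.
  rewrite [X in _ = X -> _]mxE enum_rankK /fl pS => <-.
  rewrite -mulmxA mxE dotvC; apply: eq_bigr => i _.
  rewrite [A _ _]mxE enum_rankK /g pS; congr (_ * _).
  transitivity ((c^T *m A) 0 i).
    rewrite mulmx_sum_row; congr (fun_of_matrix _ _ _).
    transitivity (\sum_v e v *: g v); last first.
      rewrite -[LHS]reindex_enum_val; apply: eq_bigr => k _.
      by rewrite rowK eE mxE.
    rewrite [LHS]big_mkcond; apply: eq_bigr => v _ /=.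
    by rewrite /g; case: ifP; rewrite ?scaler0.
  have -> : c^T *m A = (A^T *m c)^T by rewrite trmx_mul trmxK.
  by rewrite mxE.
move=> p q pS qS.
have -> : pos p - pos q = (pos p - pos v0) - (pos q - pos v0).
  by rewrite opprB addrA subrK.
by rewrite dotvBr !key // opprB addrA subrK.
Qed.

End Simplex.

(** * Conormals and the divergence theorem on a simplex *)

Section Conormals.
Context {R : realType} {d : nat} {V : finType}.
Variable pos : V -> 'rV[R]_d.
Local Notation poly := (mpoly d R).
Local Notation vec := 'rV[R]_d.
Implicit Types (S F T : {set V}) (p q : poly) (c : V -> R) (a n : vec).

Lemma facetsP S F : reflect (exists2 v, v \in S & F = S :\ v) (F \in facets S).
Proof.
apply: (iffP idP) => [|[v vS ->]]; last first.
  by rewrite inE subsetDl (cardsD1 v S) vS eqxx.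
rewrite inE => /andP[FS /eqP cF].
have : #|S :\: F| = 1%N.
  by rewrite cardsD (finset.setIidPr FS) -cF subSnn.
move/eqP/cards1P => [v Sv]; exists v.
  have : v \in S :\: F by rewrite Sv inE.
  by rewrite inE => /andP[].
by rewrite -Sv finset.setDDr finset.setDv finset.set0U (finset.setIidPr FS).
Qed.

Lemma setD1_facet S v : v \in S -> S :\ v \in facets S.
Proof. by move=> vS; apply/facetsP; exists v. Qed.

Lemma big_facets (W : nmodType) S (G : {set V} -> W) :
  \sum_(F in facets S) G F = \sum_(v in S) G (S :\ v).
Proof.
have -> : facets S = [set S :\ v | v in S]%SET.
  apply/finset.setP => F; apply/facetsP/imsetP => [[v vS ->]|[v vS ->]];
  by exists v.
rewrite big_imset // => v w vS wS /finset.setP /(_ v).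
by move=> e; apply/eqP/negPn/negP => vw; move: e; rewrite !inE eqxx vw vS.
Qed.

Definition tangent S a : Prop := exists c,
  [/\ forall v, v \notin S -> c v = 0, \sum_(v in S) c v = 0 &
      a = \sum_(v in S) c v *: pos v].

Lemma tangent_mask S c : \sum_(v in S) c v = 0 ->
  tangent S (\sum_(v in S) c v *: pos v).
Proof.
move=> c0; exists (fun v => if v \in S then c v else 0); split.
- by move=> v /negbTE ->.
- by rewrite -[RHS]c0; apply: eq_bigr => v ->.
- by apply: eq_bigr => v ->.
Qed.

(** Choosing for [k] the value of [dotv n] on a facet leaves only the term of the opposite
    vertex. *)
Lemma dotv_tangent S c n (k : R) : \sum_(v in S) c v = 0 ->
  dotv n (\sum_(v in S) c v *: pos v) =
  \sum_(v in S) c v * (dotv n (pos v) - k).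
Proof.
move=> c0; rewrite dotv_sumr (eq_bigr (fun v => c v * dotv n (pos v))).
  under [RHS]eq_bigr do rewrite mulrBr.
  by rewrite sumrB -mulr_suml c0 mul0r subr0.
by move=> v _; rewrite dotvZr.
Qed.

Lemma tangent_normal F a n : unit_normal pos F n -> tangent F a -> dotv n a = 0.
Proof.
move=> [_ nF] [c [_ c0 ->]]; have [->|[v0 v0F]] := set_0Vmem F.
  by rewrite big_set0 dotv0r.
rewrite (dotv_tangent _ (dotv n (pos v0)) c0) big1 // => v vF.
by rewrite -dotvBr nF // mulr0.
Qed.

(** The normalised gradient of one minus the barycentric coordinate of [v]: this function is 1 on
    the facet and 0 at [v], so its gradient is normal to the facet and points out of [S]. *)
Lemma conormal_exists S v : affinely_independent pos S -> v \in S ->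
  (1 < #|S|)%N -> exists n, [/\ unit_normal pos (S :\ v) n,
    forall p q : V, p \in S :\ v -> q \in S :\: (S :\ v) ->
      0 < dotv n (pos p - pos q) &
    exists2 c : V -> R, \sum_(v in S) c v = 0 &
      n = \sum_(v in S) c v *: pos v].
Proof.
move=> indS vS S1.
have [c [_ c0 cn]] := riesz_simplex (fun w => (w != v)%:R) indS.
set n0 := \sum_(w in S) c w *: pos w in cn.
have [p0 p0F] : exists p : V, p \in S :\ v.
  by apply/set0Pn; rewrite -card_gt0; move: S1; rewrite (cardsD1 v S) vS.
have n0n : 0 < dotv n0 n0.
  rewrite lt0r dotv_ge0 andbT; apply/eqP => /dotv_eq0 n00.
  have := cn p0 v; rewrite n00 dotv0l eqxx subr0.
  move: p0F; rewrite !inE => /andP[-> ->] /(_ erefl vS) /eqP.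
  by rewrite eq_sym oner_eq0.
set l := Num.sqrt (dotv n0 n0).
have l0 : 0 < l by rewrite sqrtr_gt0.
have inS (p : V) : p \in S :\ v -> p \in S by rewrite inE => /andP[].
have nev (p : V) : p \in S :\ v -> p != v by rewrite !inE => /andP[].
exists (l^-1 *: n0); split.
- split=> [|p q pF qF].
    rewrite dotvZl dotvZr mulrA -invfM -expr2 sqr_sqrtr ?dotv_ge0 //.
    by rewrite mulVf // gt_eqF.
  by rewrite dotvZl cn ?inS // !nev // subrr mulr0.
- move=> p q pF; rewrite !inE => /andP[]; rewrite negb_and negbK.
  move=> /orP[/eqP ->|/negbTE -> //] _.
  by rewrite dotvZl (cn p v (inS p pF) vS) (nev p pF) eqxx subr0 mulr1 invr_gt0.
- exists (fun w => l^-1 * c w); first by rewrite -mulr_sumr c0 mulr0.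
  by rewrite scaler_sumr; apply: eq_bigr => w _; rewrite scalerA.
Qed.

(** Beyond the defining properties of the conormal, this extracts [h], the height of [v] over the
    opposite facet. *)
Lemma conormal_spec S v : affinely_independent pos S -> v \in S ->
  (1 < #|S|)%N -> let n := conormal pos S (S :\ v) in
  exists2 h : R, 0 < h & [/\ unit_normal pos (S :\ v) n, tangent S n &
    forall p : V, p \in S :\ v -> dotv n (pos p - pos v) = h].
Proof.
move=> indS vS S1 n.
have [nF npos nT] : [/\ unit_normal pos (S :\ v) n,
    forall p q : V, p \in S :\ v -> q \in S :\: (S :\ v) ->
      0 < dotv n (pos p - pos q) &
    exists2 c : V -> R, \sum_(v in S) c v = 0 &
      n = \sum_(v in S) c v *: pos v] := xgetPex 0 (conormal_exists indS vS S1).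
have [p0 p0F] : exists p : V, p \in S :\ v.
  by apply/set0Pn; rewrite -card_gt0; move: S1; rewrite (cardsD1 v S) vS.
exists (dotv n (pos p0 - pos v)); first by apply: npos => //; rewrite !inE eqxx.
split=> //; first by case: nT => c c0 ->; apply: tangent_mask.
move=> p pF; apply/eqP; rewrite -subr_eq0 -dotvBr opprB addrA subrK.
by case: nF => _ ->.
Qed.

Lemma conormal_unit S F : affinely_independent pos S -> (1 < #|S|)%N ->
  F \in facets S -> unit_normal pos F (conormal pos S F).
Proof.
move=> indS S1 /facetsP[v vS ->].
by have [h _ []] := conormal_spec indS vS S1.
Qed.

Lemma jacE S : jac pos S = Num.sqrt (gram #|S|.-1 (vertex pos S)).
Proof. by []. Qed.

Lemma gram_conormal S v : affinely_independent pos S -> v \in S ->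
  (1 < #|S|)%N -> exists h : R, [/\ 0 < h,
    forall p : V, p \in S :\ v ->
      dotv (conormal pos S (S :\ v)) (pos p - pos v) = h &
    gram #|S|.-1 (vertex pos S) =
      h ^+ 2 * gram #|S :\ v|.-1 (vertex pos (S :\ v))].
Proof.
move=> indS vS S1.
have [h h0 [[n1 nF] [c [cS c0 nE]] nh]] := conormal_spec indS vS S1.
exists h; split=> //.
have [m cS2] : exists m, #|S| = m.+2 by case: #|S| S1 => [|[|m]] // _; exists m.
have cF : #|S :\ v| = m.+1 by move: cS2; rewrite (cardsD1 v S) vS => -[].
rewrite cS2 cF /=.
rewrite (eq_gram (x := vertex pos (S :\ v))
  (y := vertex pos S \o bump (index v (enum S)))); last first.
  by move=> i im; rewrite /= -vertex_setD1 // cS2 !ltnS.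
have cE : #|S| = size (enum S) by rewrite cardE.
have jS : (index v (enum S) <= m.+1)%N.
  by rewrite -ltnS -cS2 cE index_mem mem_enum.
have nE' : \sum_(i < m.+2) c (nth v (enum S) i) *: vertex pos S i
    = conormal pos S (S :\ v).
  rewrite nE (big_enum_nth _ _ v) /= cS2; apply: eq_bigr => i _.
  by rewrite (vertexE _ v) // cS2.
apply: (@gram_height _ _ _ _ _ (fun i => c (nth v (enum S) i))) => //.
- by rewrite -[RHS]c0 [in RHS](big_enum_nth _ _ v) /= cS2.
- by rewrite nE'.
move=> i im ij; rewrite nE' !(vertexE _ v) ?cS2 // nth_index ?mem_enum //.
apply: nh; rewrite !inE -mem_enum mem_nth -?cE ?cS2 // andbT.
apply: contraNneq ij => <-; rewrite index_uniq ?enum_uniq -?cE ?cS2 //.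
Qed.

(** Removing the vertices one at a time exhibits the determinant as a product of squared positive
    heights. *)
Lemma gram_gt0 S : affinely_independent pos S -> (0 < #|S|)%N ->
  0 < gram #|S|.-1 (vertex pos S).
Proof.
have [k] := ubnP #|S|; elim: k S => // k IH S Sk indS S0.
have [S1|S1] := ltnP 1 #|S|; last first.
  have -> : #|S| = 1%N by apply/eqP; rewrite eqn_leq S1.
  by rewrite /gram det_mx00.
have /card_gt0P [v vS] := S0.
have [h [h0 _ ->]] := gram_conormal indS vS S1.
rewrite mulr_gt0 ?exprn_gt0 //; apply: IH.
- by move: Sk; rewrite (cardsD1 v S) vS ltnS.
- by apply: affinely_independentW indS; apply: subsetDl.
- by move: S1; rewrite (cardsD1 v S) vS.
Qed.

Lemma jac_gt0 S : affinely_independent pos S -> (0 < #|S|)%N -> 0 < jac pos S.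
Proof. by move=> indS S0; rewrite jacE sqrtr_gt0 gram_gt0. Qed.

(** The inner product of the direction with the conormal is [- h * c v], and the Jacobian of [S] is
    [h] times that of the facet. This converts the coefficients of [bint_div] into fluxes. *)
Lemma jac_conormal S v c : affinely_independent pos S -> v \in S ->
  (1 < #|S|)%N -> \sum_(v in S) c v = 0 ->
  jac pos S * c v = - dotv (\sum_(v in S) c v *: pos v)
                           (conormal pos S (S :\ v)) * jac pos (S :\ v).
Proof.
move=> indS vS S1 c0.
have [h [h0 nh gE]] := gram_conormal indS vS S1.
rewrite !jacE gE sqrtrM ?sqr_ge0 // sqrtr_sqr gtr0_norm // mulrAC.
congr (_ * _); rewrite dotvC.
set n := conormal _ _ _ in nh *.
have -> : dotv n (\sum_(w in S) c w *: pos w) = - (h * c v).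
  rewrite (dotv_tangent _ (dotv n (pos v) + h) c0) (bigD1 v) //=.
  rewrite big1 => [|w /andP[wS wv]].
    by rewrite opprD addrA subrr sub0r addr0 mulrN mulrC.
  by rewrite opprD addrA -dotvBr nh ?subrr ?mulr0 // !inE wv.
by rewrite opprK.
Qed.

Lemma divergence_simplex S a p : affinely_independent pos S -> (1 < #|S|)%N ->
  tangent S a -> pint pos S (dirder a p) =
    \sum_(F in facets S) dotv a (conormal pos S F) * pint pos F p.
Proof.
move=> indS S1 [c [cS c0 aE]].
have S0 : (0 < #|S|)%N by apply: ltnW.
have aE' : a = \sum_v c v *: pos v by rewrite aE (sum_zero_out _ cS).
rewrite pintE // {1}aE' -dirder_lift_poly bint_div // big_facets.
rewrite mulrN mulr_sumr -sumrN; apply: eq_bigr => v vS.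
rewrite pintE; last by move: S1; rewrite (cardsD1 v S) vS.
rewrite [jac pos S * _]mulrA (jac_conormal indS vS S1 c0) -aE.
by rewrite !mulNr opprK mulrA.
Qed.

(** The tangential gradient [b] of the affine function [dotv a] must be [a]: their difference is
    orthogonal to all edges, and the edge matrix has full rank since its Gram determinant is
    positive. *)
Lemma tangent_full T a : affinely_independent pos T -> #|T| = d.+1 ->
  tangent T a.
Proof.
move=> indT cT.
have T0 : (0 < #|T|)%N by rewrite cT.
have [c [_ c0 cn]] := riesz_simplex (fun v => dotv a (pos v)) indT.
suff -> : a = \sum_(v in T) c v *: pos v by apply: tangent_mask.
set b := \sum_(v in T) _ in cn *.
have ab v w : v \in T -> w \in T -> dotv (a - b) (pos v - pos w) = 0.
  by move=> vT wT; rewrite dotvBl cn // dotvBr subrr.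
apply/eqP; rewrite -subr_eq0; apply/eqP.
have Ab : edges pos T *m (a - b)^T = 0.
  have /card_gt0P [v0 _] := T0.
  apply/colP => i; rewrite !mxE.
  have iT : (i.+1 < #|T|)%N by rewrite -ltn_predRL.
  rewrite -[RHS](ab (nth v0 (enum T) i.+1) (nth v0 (enum T) 0)).
  - rewrite dotvC; apply: eq_bigr => k _.
    by rewrite !mxE !(vertexE _ v0) //.
  - by rewrite -mem_enum mem_nth // -cardE.
  - by rewrite -mem_enum mem_nth // -cardE.
have : row_full (edges pos T).
  rewrite /row_full eqn_leq rank_leq_col /=.
  have : edges pos T *m (edges pos T)^T \in unitmx.
    by rewrite unitmxE unitfE gt_eqF // (gram_gt0 indT).
  rewrite -row_full_unit /row_full => /eqP rk.
  apply: (@leq_trans #|T|.-1); first by rewrite cT.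
  by rewrite -[X in (X <= _)%N]rk mxrankM_maxl.
move=> /row_fullP [B BA]; apply: trmx_inj.
by rewrite -[LHS]mul1mx -BA -mulmxA Ab mulmx0 trmx0.
Qed.

(** By [jac_conormal], a direction orthogonal to the conormal has coefficient zero at the opposite
    vertex. *)
Lemma tangent_facet T F a : affinely_independent pos T -> #|T| = d.+1 ->
  (1 < #|T|)%N -> F \in facets T -> dotv a (conormal pos T F) = 0 ->
  tangent F a.
Proof.
move=> indT cT T1 /facetsP[v vT ->] an.
have [c [cS c0 aE]] := tangent_full a indT cT.
have cv : c v = 0.
  have := jac_conormal indT vT T1 c0; rewrite -aE an oppr0 mul0r => /eqP.
  rewrite mulf_eq0 gt_eqF /= => [/eqP //|].
  by rewrite jac_gt0 // cT.
exists c; split.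
- move=> w; rewrite !inE negb_and negbK => /orP[/eqP -> //|]; exact: cS.
- by move: c0; rewrite (big_setD1 v) //= cv add0r.
- by rewrite aE (big_setD1 v) //= cv scale0r add0r.
Qed.

(* With B the product of the barycentric coordinates of T, if P is orthogonal to
   B^j Q for all Q then, B vanishing on the boundary, integration by parts shows
   that the derivatives of P are orthogonal to B^(j+1) Q for all Q; induct on the
   degree of P. *)
Lemma bint_nondeg T p : affinely_independent pos T -> #|T| = d.+1 ->
  (1 < #|T|)%N ->
  (forall Q, bint T (lift_poly pos p * Q) = 0) -> p = 0.
Proof.
move=> indT cT T1.
have T0 : (0 < #|T|)%N by rewrite cT.
pose mT : multinom #|V| :=
  Multinom [tuple nat_of_bool (enum_val i \in T) | i < #|V|].
pose B : mpoly #|V| R := mpolyX R mT.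
(* For constant [q] the test [Q = 1] leaves [q] times the integral of [B ^+ j], which is
   positive. *)
have const j q : deg_le 0 q ->
    (forall Q, bint T (lift_poly pos q * B ^+ j * Q) = 0) -> q = 0.
  move=> /deg_leP q0 Hq.
  have qC : q = mpolyC d (mcoeff mnm0 q).
    apply/mpolyP => m; rewrite mcoeffC.
    have [->|m0] := eqVneq m mnm0; first by rewrite mulr1.
    by rewrite mulr0 q0 // lt0n mdeg_eq0.
  have := Hq 1; rewrite qC /lift_poly comp_mpolyC mulr1 mul_mpolyC bintZ //.
  rewrite mpolyXn bint_mono // => /eqP; rewrite mulf_eq0 => /orP[/eqP ->|].
    by rewrite mpolyC0.
  rewrite /bweight; case: ifP => [_|/negbT].
    rewrite gt_eqF // divr_gt0 // ltr0n ?fact_gt0 // prodn_gt0 // => v.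
    by rewrite fact_gt0.
  rewrite negb_forall => /existsP[v]; rewrite negb_imply => /andP[].
  rewrite /expo mulmnE /mT mnmE enum_rankK => + /negbTE vT.
  by rewrite vT mul0n.
suff H k j q : deg_le k q ->
    (forall Q, bint T (lift_poly pos q * B ^+ j * Q) = 0) -> q = 0.
  move=> Hp; apply: (H (mmeasure mdeg p) 0%N) => [|Q].
    by rewrite /deg_le.
  by rewrite expr0 mulr1 Hp.
elim: k j q => [|k IH] j q; first exact: const.
move=> qk Hq.
have dq i : mderiv i q = 0.
  apply: (IH j.+1) => [|Q].
    apply/deg_leP => m km; rewrite mcoeff_mderiv.
    move/deg_leP: qk => -> //; first by rewrite mul0rn.
    by rewrite mdegD mdeg1 addn1 ltnS.
  have [c [cS c0 aE]] := tangent_full (delta_mx 0 i) indT cT.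
  have dE : \sum_v c v *: mderiv (enum_rank v) (lift_poly pos q)
      = lift_poly pos (mderiv i q).
    rewrite dirder_lift_poly (sum_zero_out _ cS) -aE; congr lift_poly.
    rewrite /dirder (bigD1 i) //= big1 ?addr0 => [|l li].
      by rewrite mxE !eqxx scale1r.
    by rewrite mxE (negbTE li) andbF scale0r.
  pose D P := \sum_v c v *: mderiv (enum_rank v) P.
  have DM P P' : D (P * P') = D P * P' + P * D P'.
    rewrite /D mulr_suml mulr_sumr -big_split /=; apply: eq_bigr => v _.
    by rewrite mderivM scalerDr scalerAl scalerAr.
  have DX P l : D (P ^+ l.+1) = P ^+ l * ((l.+1)%:R * D P).
    elim: l => [|l IHl]; first by rewrite expr0 !mul1r.
    rewrite exprS DM IHl [X in _ + X]mulrA -exprS [D P * _]mulrC.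
    by rewrite -mulrDr -[l.+2%:R]natr1 mulrDl mul1r addrC.
  (* The facet terms vanish because [B] contains the coordinate of every vertex of [T]. In the
     product rule, the terms not differentiating [q] keep a factor [q * B ^+ j] and vanish by
     hypothesis. *)
  have := @bint_div _ _ T c (lift_poly pos q * (B ^+ j.+1 * Q)) T1 cS c0.
  rewrite [X in _ = - X -> _]big1 => [|v vT]; last first.
    rewrite (@bint_vanish _ _ _ v _ (mpolyX R (mnm_sub mT (mnm1 (enum_rank v)))
      * (lift_poly pos q * (B ^+ j * Q)))) ?mulr0 //.
    - by move: T1; rewrite (cardsD1 v T) vT.
    - by rewrite !inE eqxx.
    - rewrite [X in _ = X]mulrA -mpolyXD (_ : mnm_add _ _ = mT).
        by rewrite -/B exprS; ring.
      apply/mnmP => i'; rewrite mnmDE mnmBE mnm1E subnKC //.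
      rewrite /mT mnmE; case: eqP => // <-; by rewrite enum_rankK vT.
  rewrite oppr0 -/(D _) DM /D dE -/(D _) DM DX.
  rewrite bintD // mulrA => E; rewrite -[RHS]E.
  rewrite -[LHS]addr0; congr (_ + _); apply/esym.
  rewrite -[RHS](Hq ((j.+1)%:R * D B * Q + B * D Q)); congr bint.
  by rewrite exprS; ring.
apply: (const j) => //; apply/deg_leP => m m0.
have [i mi] : exists i, (0 < m i)%N.
  apply/existsP; apply: contraLR m0; rewrite negb_exists => /forallP m0.
  rewrite -leqNgt leqn0 mdegE; apply/eqP/big1 => i _.
  by apply/eqP; rewrite eqn0Ngt.
have := mcoeff_mderiv i q (mnm_sub m (mnm1 i)).
rewrite dq mcoeff0 (_ : mnm_add _ _ = m).
  by move/esym/eqP; rewrite mulrn_eq0 /= => /eqP.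
apply/mnmP => i'; rewrite mnmDE mnmBE mnm1E subnK //.
by case: eqP => // <-.
Qed.

Lemma bint_psd_eq0 S (P Q : mpoly #|V| R) : (0 < #|S|)%N ->
  bint S (P * P) = 0 -> bint S (P * Q) = 0.
Proof.
move=> S0; apply: (psd_eq0 (B := fun P Q => bint S (P * Q)))
  => [b P1 P2 P3|P1 P2|P1].
- by rewrite mulrDl -scalerAl bint_linear.
- by rewrite mulrC.
- exact: bint_sqr_ge0.
Qed.

Lemma pint_psd_eq0 S p q : (0 < #|S|)%N -> pint pos S (p * p) = 0 ->
  pint pos S (p * q) = 0.
Proof.
move=> S0; apply: (psd_eq0 (B := fun p q => pint pos S (p * q)))
  => [b p1 p2 p3|p1 p2|p1].
- by rewrite mulrDl -scalerAl pint_linear.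
- by rewrite mulrC.
- exact: pint_sqr_ge0.
Qed.

(** By Cauchy-Schwarz [p] is orthogonal to all barycentric polynomials, including those that are not
    lifts, as [bint_nondeg] demands. *)
Lemma pint_definite T p : affinely_independent pos T -> #|T| = d.+1 ->
  (1 < #|T|)%N -> pint pos T (p * p) = 0 -> p = 0.
Proof.
move=> indT cT T1 pp; apply: (bint_nondeg indT cT T1) => Q.
have T0 : (0 < #|T|)%N by rewrite cT.
apply: bint_psd_eq0 => //; move/eqP: pp; rewrite pintE // mulf_eq0.
by rewrite gt_eqF ?jac_gt0 //= lift_polyM => /eqP.
Qed.

End Conormals.

(** * Integration by parts for the Hessian *)

Section Green.
Context {R : realType} {d : nat} {V : finType}.
Variable pos : V -> 'rV[R]_d.
Local Notation poly := (mpoly d R).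
Local Notation vec := 'rV[R]_d.
Implicit Types (S F T e : {set V}) (p q : poly) (a n : vec) (w : 'I_d -> poly)
  (t : 'M[poly]_d).

Lemma mderiv_comm (i j : 'I_d) p : mderiv i (mderiv j p) = mderiv j (mderiv i p).
Proof.
apply/mpolyP => m; rewrite !mcoeff_mderiv.
have -> : mnm_add (mnm_add m (mnm1 i)) (mnm1 j) =
          mnm_add (mnm_add m (mnm1 j)) (mnm1 i).
  by rewrite -!addmA; congr mnm_add; rewrite addmC.
rewrite -!mulrnA; congr (_ *+ _); rewrite !mnmDE !mnm1E.
have [->|ij] := eqVneq i j; first by [].
by rewrite !addn0 mulnC.
Qed.

Lemma dirder_delta (i : 'I_d) p : dirder (delta_mx 0 i) p = mderiv i p.
Proof.
rewrite /dirder (bigD1 i) //= big1 ?addr0 => [|l li].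
  by rewrite mxE !eqxx scale1r.
by rewrite mxE (negbTE li) andbF scale0r.
Qed.

Lemma dirderM a p q : dirder a (p * q) = dirder a p * q + p * dirder a q.
Proof.
rewrite /dirder mulr_suml mulr_sumr -big_split /=; apply: eq_bigr => i _.
by rewrite mderivM scalerDr scalerAl scalerAr.
Qed.

Lemma dirder_linear (b : R) a a' p :
  dirder (b *: a + a') p = b *: dirder a p + dirder a' p.
Proof.
rewrite /dirder scaler_sumr -big_split /=; apply: eq_bigr => i _.
by rewrite !mxE scalerDl scalerA.
Qed.

Lemma dotv_delta (i : 'I_d) n : dotv (delta_mx 0 i) n = n 0 i.
Proof.
rewrite /dotv (bigD1 i) //= big1 ?addr0 => [|l li].
  by rewrite mxE !eqxx mul1r.
by rewrite mxE (negbTE li) andbF mul0r.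
Qed.

Lemma vdotM n p w : vdot n (fun i => p * w i) = p * vdot n w.
Proof. by rewrite mulr_sumr; apply: eq_bigr => i _; rewrite scalerAr. Qed.

Lemma divvM p w :
  divv (fun i => p * w i) = \sum_i mderiv i p * w i + p * divv w.
Proof.
rewrite /divv mulr_sumr -big_split /=; apply: eq_bigr => i _.
by rewrite mderivM.
Qed.

Lemma vdot_tangential n w : dotv n n = 1 -> vdot n (tangential n w) = 0.
Proof.
move=> n1; rewrite /tangential /vdot.
under eq_bigr do rewrite scalerBr scalerA.
by rewrite sumrB -scaler_suml -/(dotv n n) n1 scale1r subrr.
Qed.

Lemma vdot_tangential_orth n a w : dotv n a = 0 ->
  vdot a (tangential n w) = vdot a w.
Proof.
move=> na; rewrite /tangential /vdot.
under eq_bigr do rewrite scalerBr scalerA.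
rewrite sumrB -scaler_suml (_ : \sum_i _ = dotv n a) ?na ?scale0r ?subr0 //.
by rewrite -[RHS]na; apply: eq_bigr => i _; rewrite mulrC.
Qed.

(** For a unit [n], the orthogonal projection of the [i]-th basis vector onto the hyperplane normal
    to [n]. *)
Definition proj_delta n (i : 'I_d) : vec := (- n 0 i) *: n + delta_mx 0 i.

Lemma surf_divE n w : surf_div n w = \sum_i dirder (proj_delta n i) (w i).
Proof.
rewrite /surf_div addrC -sumrN -big_split /=; apply: eq_bigr => i _.
by rewrite dirder_linear dirder_delta scaleNr.
Qed.

Lemma surf_divM n p w : vdot n w = 0 ->
  surf_div n (fun i => p * w i) = \sum_i mderiv i p * w i + p * surf_div n w.
Proof.
move=> nw; rewrite !surf_divE mulr_sumr.
under eq_bigr do rewrite dirderM.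
rewrite big_split /=; congr (_ + _).
under eq_bigr do rewrite dirder_linear dirder_delta mulrDl -scalerAl scaleNr.
rewrite big_split /= sumrN.
have -> : \sum_i n 0 i *: (dirder n p * w i) = 0.
  by under eq_bigr do rewrite scalerAr; rewrite -mulr_sumr -/(vdot n w) nw mulr0.
by rewrite oppr0 add0r.
Qed.

Section Cell.
Variable T : {set V}.
Hypotheses (d2 : (2 <= d)%N) (indT : affinely_independent pos T)
  (cT : #|T| = d.+1).

Let T0 : (0 < #|T|)%N. Proof. by rewrite cT. Qed.
Let T1 : (1 < #|T|)%N. Proof. by rewrite cT ltnS ltnW. Qed.

Lemma card_facet F : F \in facets T -> #|F| = d.
Proof. by rewrite inE cT eqSS => /andP[_ /eqP]. Qed.

Lemma facet_gt0 F : F \in facets T -> (0 < #|F|)%N.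
Proof. by move=> /card_facet ->; apply: ltnW. Qed.

Lemma facet_gt1 F : F \in facets T -> (1 < #|F|)%N.
Proof. by move=> /card_facet ->. Qed.

Lemma facet_indep F : F \in facets T -> affinely_independent pos F.
Proof. by rewrite inE => /andP[FT _]; apply: affinely_independentW indT. Qed.

Lemma card_facet_facet F e : F \in facets T -> e \in facets F -> (0 < #|e|)%N.
Proof.
move=> FT; have := facet_gt1 FT; rewrite inE => F1 /andP[_ /eqP eF].
by move: F1; rewrite -eF.
Qed.

Lemma divergence_cell w : pint pos T (divv w) =
  \sum_(F in facets T) pint pos F (vdot (conormal pos T F) w).
Proof.
rewrite /divv pint_sum //.
transitivity (\sum_i \sum_(F in facets T)
    conormal pos T F 0 i * pint pos F (w i)).
  apply: eq_bigr => i _; rewrite -dirder_delta divergence_simplex //.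
    by apply: eq_bigr => F _; rewrite dotv_delta.
  exact: tangent_full.
rewrite exchange_big /=; apply: eq_bigr => F FT.
rewrite pint_sum ?facet_gt0 //; apply: eq_bigr => i _.
by rewrite pintZ ?facet_gt0.
Qed.

(** The directions [proj_delta] are tangent to [F], so the divergence theorem applies within the
    facet. The conormals of [F] are orthogonal to the normal of [F], so the projection does not
    alter the fluxes. *)
Lemma divergence_facet F w : F \in facets T ->
  pint pos F (surf_div (conormal pos T F) w) =
  \sum_(e in facets F) pint pos e (vdot (conormal pos F e) w).
Proof.
move=> FT; set n := conormal pos T F.
have [n1 nF] : unit_normal pos F n by apply: conormal_unit.
rewrite surf_divE pint_sum ?facet_gt0 //.
transitivity (\sum_i \sum_(e in facets F)
    conormal pos F e 0 i * pint pos e (w i)).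
  apply: eq_bigr => i _.
  have an : dotv (proj_delta n i) n = 0.
    by rewrite dotv_linearl n1 mulr1 dotv_delta addNr.
  rewrite divergence_simplex ?facet_gt1 //; last 2 first.
  - exact: facet_indep FT.
  - exact: tangent_facet an.
  apply: eq_bigr => e eF; congr (_ * _).
  have [v vF eE] := facetsP _ _ eF.
  have [h _ [_ nT _]] := conormal_spec (facet_indep FT) vF (facet_gt1 FT).
  rewrite dotv_linearl dotv_delta eE.
  by rewrite (tangent_normal (conj n1 nF) nT) mulr0 add0r.
rewrite exchange_big /=; apply: eq_bigr => e eF.
have e0 := card_facet_facet FT eF.
by rewrite pint_sum //; apply: eq_bigr => i _; rewrite pintZ.
Qed.

Lemma big_facets_ridges (W : nmodType) (G : {set V} -> {set V} -> W) :
  \sum_(F in facets T) \sum_(e in facets F) G F e =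
  \sum_(e in ridges T) \sum_(F in facets T | e \subset F) G F e.
Proof.
rewrite (exchange_big_dep (mem (ridges T))) /=.
  apply: eq_bigr => e; rewrite inE => /andP[eT /eqP ce].
  apply: eq_bigl => F; rewrite /facets !inE -andbA.
  case: (boolP (F \subset T)) => //= FT.
  rewrite [RHS]andbC; case: (boolP (e \subset F)) => //= eF; last by rewrite andbF.
  by rewrite -ce eqSS eq_sym andbb.
move=> F e; rewrite !inE => /andP[FT /eqP cF] /andP[eF /eqP ce].
by rewrite (fintype.subset_trans eF FT) ce cF eqxx.
Qed.

(** Only the tangential part of [w] can be integrated by parts on the facet; its normal part yields
    the normal derivative. In the ridge terms [w] itself may stand, the conormals of [F] being
    tangent to [F]. *)
Lemma green_facet F p w : F \in facets T -> let n := conormal pos T F in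
  pint pos F (\sum_i mderiv i p * w i) =
  pint pos F (dirder n p * vdot n w)
  - pint pos F (p * surf_div n (tangential n w))
  + \sum_(e in facets F) pint pos e (p * vdot (conormal pos F e) w).
Proof.
move=> FT n; have F0 := facet_gt0 FT.
have [n1 nF] : unit_normal pos F n by apply: conormal_unit.
set wt := tangential n w.
have nwt : vdot n wt = 0 by apply: vdot_tangential.
have -> : \sum_i mderiv i p * w i = dirder n p * vdot n w +
    (surf_div n (fun i => p * wt i) - p * surf_div n wt).
  rewrite surf_divM // addrK /dirder mulr_suml -big_split /=.
  apply: eq_bigr => i _; rewrite /wt /tangential mulrBr.
  by rewrite -scalerAl -scalerAr addrC subrK.
rewrite pintD // pintB // divergence_facet // -addrA; congr (_ + _).
rewrite addrC; congr (_ + _); apply: eq_bigr => e eF; congr pint.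
rewrite vdotM vdot_tangential_orth //.
have [v vF ->] := facetsP _ _ eF.
have [h _ [_ nT _]] := conormal_spec (facet_indep FT) vF (facet_gt1 FT).
exact: tangent_normal nT.
Qed.

Lemma ip_mxE (s t : 'M[poly]_d) (S : {set V}) :
  ip_mx pos S s t = \sum_i \sum_j pint pos S (s i j * t i j).
Proof. by apply: eq_bigr => i _; apply: eq_bigr => j _; rewrite ipE. Qed.

(** Two product rules write the integrand as [div (t^T grad p) - div (p div t) + p div div t]. The
    flux of the first field through a facet is [grad p . (t n)], to which [green_facet] applies; its
    ridge terms are then regrouped by ridge. *)
Lemma green_hessian p t :
  ip_mx pos T (hessian p) t =
    ip pos T (ev p) (ev (divv (row_div t)))
    - \sum_(F in facets T) ip pos F (ev p) (ev (tr2 (conormal pos T F) t))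
    + \sum_(F in facets T) ip pos F (ev (dirder (conormal pos T F) p))
                                    (ev (nn (conormal pos T F) t))
    + \sum_(e in ridges T) ip pos e (ev p) (ev (tr_e pos T e t)).
Proof.
pose w (i : 'I_d) : poly := \sum_l mderiv l p * t l i.
have E : \sum_i \sum_j hessian p i j * t i j =
    divv w - (divv (fun i => p * row_div t i) - p * divv (row_div t)).
  rewrite divvM addrK /divv.
  under [X in _ = X - _]eq_bigr => i _.
    rewrite raddf_sum /=; under eq_bigr do rewrite mderivM.
    rewrite big_split /=; over.
  rewrite big_split /= exchange_big /= [X in _ = _ + X - _]exchange_big /=.
  rewrite [X in _ = _ + X - _](eq_bigr (fun i => mderiv i p * row_div t i));
    last by move=> i _; rewrite mulr_sumr.
  rewrite addrK; apply: eq_bigr => i _; apply: eq_bigr => j _.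
  by rewrite mxE mderiv_comm.
have -> : ip_mx pos T (hessian p) t = pint pos T (\sum_i \sum_j hessian p i j * t i j).
  by rewrite ip_mxE pint_sum //; apply: eq_bigr => i _; rewrite pint_sum.
rewrite E !pintB // !divergence_cell opprB addrCA -addrA -addrA; rewrite ipE.
congr (_ + _).
have wE F : vdot (conormal pos T F) w =
    \sum_i mderiv i p * mxvec_prod t (conormal pos T F) i.
  rewrite /vdot /w; under eq_bigr do rewrite scaler_sumr.
  rewrite exchange_big /=; apply: eq_bigr => i _; rewrite mulr_sumr.
  by apply: eq_bigr => j _; rewrite scalerAr.
under eq_bigr => F FT do rewrite wE green_facet //.
rewrite big_split big_split /= sumrN.
rewrite (big_facets_ridges (fun F e => pint pos e (p * vdot (conormal pos F e)
  (mxvec_prod t (conormal pos T F))))).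
rewrite [X in _ = _ + (_ + X)](_ : _ = \sum_(e in ridges T)
  \sum_(F in facets T | e \subset F) pint pos e (p * vdot (conormal pos F e)
  (mxvec_prod t (conormal pos T F)))); last first.
  apply: eq_bigr => e; rewrite inE => /andP[_ /eqP ce].
  rewrite ipE /tr_e mulr_sumr pint_sum //.
  (* [2 <= d] makes a ridge nonempty, which linearity of [pint] requires. *)
  by move: d2; rewrite -ltnS -cT -ce !ltnS.
rewrite [RHS]addrA [LHS]addrAC; congr (_ + _).
rewrite -addrA [RHS]addrC; congr (_ + _).
  by apply: eq_bigr => F FT; rewrite ipE.
rewrite -!sumrN -big_split /=; apply: eq_bigr => F FT.
by rewrite ipE vdotM /tr2 [in RHS]mulrDr [in RHS]pintD ?facet_gt0 // opprD addrC.
Qed.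

End Cell.
End Green.

(** * Degrees of [div div] and [tr2] on the shape functions *)

Section Degrees.
Context {R : realType} {d : nat}.
Local Notation poly := (mpoly d R).
Local Notation vec := 'rV[R]_d.
Local Notation X i := (mpolyX R (mnm1 i)).
Implicit Types (p q : poly) (n : vec) (w : 'I_d -> poly) (s t : 'M[poly]_d).

Lemma deg_leW (j k : nat) p : (j <= k)%N -> deg_le j p -> deg_le k p.
Proof. by move=> jk pj; apply: leq_trans pj _; rewrite ltnS. Qed.

Lemma deg_le0 (j : nat) : deg_le j (0 : poly).
Proof. by rewrite /deg_le msize0. Qed.

Lemma deg_le_lin (j : nat) (a : R) p q : deg_le j p -> deg_le j q ->
  deg_le j (a *: p + q).
Proof.
move=> /deg_leP pj /deg_leP qj; apply/deg_leP => m jm.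
by rewrite mcoeffD mcoeffZ pj // qj // mulr0 addr0.
Qed.

Lemma deg_leD (j : nat) p q : deg_le j p -> deg_le j q -> deg_le j (p + q).
Proof. by move=> pj qj; have := deg_le_lin 1 pj qj; rewrite scale1r. Qed.

Lemma deg_leZ (j : nat) (a : R) p : deg_le j p -> deg_le j (a *: p).
Proof. by move=> pj; have := deg_le_lin a pj (deg_le0 j); rewrite addr0. Qed.

Lemma deg_leN (j : nat) p : deg_le j p -> deg_le j (- p).
Proof. by move=> pj; rewrite -scaleN1r; apply: deg_leZ. Qed.

Lemma deg_le_sum (j : nat) (I : Type) (r : seq I) (P : pred I) (F : I -> poly) :
  (forall i, P i -> deg_le j (F i)) -> deg_le j (\sum_(i <- r | P i) F i).
Proof.
move=> Fj; elim/big_ind: _ => //; first exact: deg_le0.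
by move=> p q; apply: deg_leD.
Qed.

Lemma deg_leM (j k : nat) p q : deg_le j p -> deg_le k q -> deg_le (j + k) (p * q).
Proof.
have [->|p0] := eqVneq p 0; first by rewrite mul0r => _ _; apply: deg_le0.
have [->|q0] := eqVneq q 0; first by rewrite mulr0 => _ _; apply: deg_le0.
rewrite /deg_le msizeM // => pj qk.
have : (mmeasure mdeg p + mmeasure mdeg q <= j.+1 + k.+1)%N by apply: leq_add.
by rewrite addnS addSn; case: (_ + _)%N.
Qed.

Lemma deg_leX (i : 'I_d) : deg_le 1 (X i).
Proof. by rewrite /deg_le msizeX mdeg1. Qed.

Lemma deg_le_mderiv (j : nat) i p : deg_le j p -> deg_le j.-1 (mderiv i p).
Proof.
move=> /deg_leP pj; apply/deg_leP => m jm.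
rewrite mcoeff_mderiv pj ?mul0rn // mdegD mdeg1 addn1.
by lia.
Qed.

Lemma deg_le_dirder (j : nat) n p : deg_le j p -> deg_le j.-1 (dirder n p).
Proof. by move=> pj; apply: deg_le_sum => i _; apply/deg_leZ/deg_le_mderiv. Qed.

Lemma deg_le_vdot (j : nat) n w : (forall i, deg_le j (w i)) ->
  deg_le j (vdot n w).
Proof. by move=> wj; apply: deg_le_sum => i _; apply/deg_leZ. Qed.

Lemma deg_le_divv (j : nat) w : (forall i, deg_le j (w i)) ->
  deg_le j.-1 (divv w).
Proof. by move=> wj; apply: deg_le_sum => i _; apply/deg_le_mderiv. Qed.

Lemma deg_le_row_div (j : nat) t i : (forall i j', deg_le j (t i j')) ->
  deg_le j.-1 (row_div t i).
Proof. by move=> wj; apply: deg_le_sum => l _; apply/deg_le_mderiv. Qed.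

Lemma deg_le_surf_div (j : nat) n w : (forall i, deg_le j (w i)) ->
  deg_le j.-1 (surf_div n w).
Proof.
move=> wj; apply/deg_leD; first exact: deg_le_divv.
by apply/deg_leN/deg_le_vdot => i; apply: deg_le_dirder.
Qed.

Lemma deg_le_mxvec_prod (j : nat) n t i : (forall i j', deg_le j (t i j')) ->
  deg_le j (mxvec_prod t n i).
Proof. by move=> tj; apply: deg_le_sum => l _; apply: deg_leZ. Qed.

Lemma deg_le_tangential (j : nat) n w i : (forall i, deg_le j (w i)) ->
  deg_le j (tangential n w i).
Proof. by move=> wj; apply/deg_leD => //; apply/deg_leN/deg_leZ/deg_le_vdot. Qed.

Lemma deg_le_tr2 (k : nat) n t : (forall i j, deg_le k (t i j)) ->
  deg_le k.-1 (tr2 n t).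
Proof.
move=> tk; apply: deg_leD.
  by apply: deg_le_vdot => i; apply: deg_le_row_div.
apply: deg_le_surf_div => i; apply: deg_le_tangential => l.
exact: deg_le_mxvec_prod.
Qed.

Lemma row_divD s t : row_div (s + t) = (fun i => row_div s i + row_div t i).
Proof.
apply/funext => i; rewrite -big_split /=; apply: eq_bigr => j _.
by rewrite mxE mderivD.
Qed.

Lemma divvD w w' : divv (fun i => w i + w' i) = divv w + divv w'.
Proof. by rewrite -big_split /=; apply: eq_bigr => i _; rewrite mderivD. Qed.

Lemma vdotD n w w' : vdot n (fun i => w i + w' i) = vdot n w + vdot n w'.
Proof. by rewrite -big_split /=; apply: eq_bigr => i _; rewrite scalerDr. Qed.

Lemma dirderD n p q : dirder n (p + q) = dirder n p + dirder n q.
Proof.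
by rewrite -big_split /=; apply: eq_bigr => i _; rewrite mderivD scalerDr.
Qed.

Lemma tr2D n s t : tr2 n (s + t) = tr2 n s + tr2 n t.
Proof.
have E : tangential n (mxvec_prod (s + t) n) = (fun i =>
    tangential n (mxvec_prod s n) i + tangential n (mxvec_prod t n) i).
  have -> : mxvec_prod (s + t) n = (fun i => mxvec_prod s n i + mxvec_prod t n i).
    apply/funext => i; rewrite -big_split /=; apply: eq_bigr => j _.
    by rewrite mxE scalerDr.
  by apply/funext => i; rewrite /tangential vdotD scalerDr opprD addrACA.
have sE w w' : surf_div n (fun i => w i + w' i) = surf_div n w + surf_div n w'.
  rewrite !surf_divE -big_split /=; apply: eq_bigr => i _.
  exact: dirderD.
by rewrite /tr2 row_divD vdotD E sE; rewrite [LHS]addrACA.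
Qed.

Definition lform n : poly := vdot n (fun i => X i).

Lemma mderiv_lform n i : mderiv i (lform n) = n 0 i *: 1.
Proof.
rewrite /lform raddf_sum /= (bigD1 i) //= big1 ?addr0 => [|l li].
  by rewrite mderivZ mderivXU eqxx.
by rewrite mderivZ mderivXU eq_sym (negbTE li) scaler0.
Qed.

Lemma deg_le_lform n : deg_le 1 (lform n).
Proof. by apply: deg_le_vdot => i; apply: deg_leX. Qed.

Lemma ev_lform n x : ev (lform n) x = dotv n x.
Proof.
rewrite /ev raddf_sum /=; apply: eq_bigr => i _.
by rewrite mevalZ mevalXU.
Qed.

(** The scalar factor in [div (x x^T q) = x (euler q)]. *)
Definition euler q : poly := q *+ d.+1 + \sum_j X j * mderiv j q.

Lemma deg_le_euler (j : nat) q : deg_le j q -> deg_le j (euler q).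
Proof.
move=> qj; apply: deg_leD; first by rewrite -scaler_nat; apply: deg_leZ.
apply: deg_le_sum => i _; case: j qj => [|j] qj.
  suff -> : mderiv i q = 0 by rewrite mulr0; apply: deg_le0.
  apply/mpolyP => m; rewrite mcoeff_mderiv mcoeff0.
  move/deg_leP: qj => -> //; first by rewrite mul0rn.
  by rewrite mdegD mdeg1 addn1.
by rewrite -add1n; apply: deg_leM (deg_leX i) (deg_le_mderiv i qj).
Qed.

Lemma row_div_xxT q i : row_div (xxT q) i = X i * euler q.
Proof.
rewrite /row_div /euler mulrDr mulr_sumr mulrSr mulrDr -addrA addrC -addrA addrC.
transitivity (\sum_j ((i == j)%:R * X j * q + X i * q + X i * (X j * mderiv j q))).
  apply: eq_bigr => j _; rewrite mxE mderivM mderivM !mderivXU eqxx mulr1.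
  by rewrite mulrDl [j == i]eq_sym mulrA.
rewrite !big_split /= addrAC sumr_const card_ord -mulrnAr addrC.
rewrite [Z in _ + (Z + _)](_ : _ = X i * q).
  by rewrite [LHS]addrC -[LHS]addrA [LHS]addrC.
rewrite (bigD1 i) //= big1 ?addr0 => [|j ij]; first by rewrite eqxx mul1r.
by rewrite eq_sym (negbTE ij) !mul0r.
Qed.

(** Since [x x^T q n = (n . x) q x], every term keeps the factor [n . x]. The surface divergence can
    be taken past it because its gradient [n] is orthogonal to the tangential field [y]. *)
Lemma tr2_xxT n q : dotv n n = 1 -> exists2 g, tr2 n (xxT q) = lform n * g &
  forall j, deg_le j q -> deg_le j g.
Proof.
move=> n1; pose y (i : 'I_d) : poly := (X i - n 0 i *: lform n) * q.
exists (euler q + surf_div n y) => [|j qj]; last first.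
  apply: deg_leD; first exact: deg_le_euler.
  apply: (@deg_le_surf_div j.+1) => i; rewrite -add1n.
  apply: deg_leM => //; apply: deg_leD; first exact: deg_leX.
  exact/deg_leN/deg_leZ/deg_le_lform.
rewrite /tr2 mulrDr; congr (_ + _).
  rewrite /vdot /lform mulr_suml; apply: eq_bigr => i _.
  by rewrite row_div_xxT scalerAl.
have mE i : mxvec_prod (xxT q) n i = X i * (lform n * q).
  rewrite /mxvec_prod /lform mulr_suml mulr_sumr; apply: eq_bigr => j _.
  by rewrite mxE -scalerAl -scalerAr mulrA.
have -> : tangential n (mxvec_prod (xxT q) n) = (fun i => lform n * y i).
  apply/funext => i; rewrite /tangential mE.
  have -> : vdot n (mxvec_prod (xxT q) n) = lform n * (lform n * q).
    rewrite /vdot {2}/lform mulr_suml; apply: eq_bigr => j _.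
    by rewrite mE scalerAl.
  by rewrite /y mulrBl mulrBr -scalerAl -scalerAr; congr (_ - _); rewrite mulrCA.
have ny : vdot n y = 0.
  rewrite /vdot /y; under eq_bigr do rewrite mulrBl scalerBr scalerAl.
  rewrite sumrB -mulr_suml; under [Z in _ - Z]eq_bigr do rewrite -scalerAl scalerA.
  by rewrite -scaler_suml -/(dotv n n) n1 scale1r subrr.
rewrite surf_divM // (_ : \sum_i _ = vdot n y) ?ny ?add0r //.
by rewrite -[RHS]ny; apply: eq_bigr => i _; rewrite mderiv_lform -scalerAl mul1r.
Qed.

(** For the enriched part, one divergence of [x x^T q] still has degree [k], so the second leaves
    degree [k - 1], matching the choice of [r]. *)
Lemma sigma_divdiv (k r : nat) t : (2 <= k)%N -> r = (k - 2)%N \/ r = (k - 1)%N ->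
  Sigma k r t -> deg_le r (divv (row_div t)).
Proof.
move=> k2 kr [s [_ sk]].
have sr : deg_le (k - 2) (divv (row_div s)).
  rewrite subn2; apply: deg_le_divv => i; exact: deg_le_row_div.
case: kr => ->.
  rewrite (_ : (_ == _) = false) => [->//|]; apply/negbTE; lia.
rewrite subn1 eqxx => -[q qh ->].
rewrite row_divD divvD; apply: deg_leD; first by apply: deg_leW sr; lia.
have qk : deg_le k.-1 q.
  apply/deg_leP => m km; move: qh => /dhomog_nemf_coeff -> //.
  by rewrite gtn_eqF.
apply: (@deg_le_divv k) => i; rewrite row_div_xxT -{1}(prednK (ltnW k2)) -add1n.
by apply: deg_leM (deg_leX i) (deg_le_euler qk).
Qed.

(** As a polynomial the enriched part of [tr2] may have degree [k]; on the face its factor [n . x]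
    is the constant [dotv n (pos v0)], which leaves degree [k - 1]. *)
Lemma sigma_tr2 (V : finType) (pos : V -> vec) (F : {set V}) (k r : nat) n t :
  (2 <= k)%N -> Sigma k r t -> unit_normal pos F n -> exists2 g,
    deg_le k.-1 g & forall x, hull pos F x -> ev (tr2 n t) x = ev g x.
Proof.
move=> k2 [s [_ sk]] + [n1 nF].
have sr : deg_le k.-1 (tr2 n s) by apply: deg_le_tr2.
case: ifP => _; last by move=> ->; exists (tr2 n s).
move=> [q qh ->].
have qk : deg_le k.-1 q.
  apply/deg_leP => m km; move: qh => /dhomog_nemf_coeff -> //.
  by rewrite gtn_eqF.
have [g gE gk] := tr2_xxT q n1.
have [F0|[v0 v0F]] := set_0Vmem F.
  exists 0; first exact: deg_le0.
  move=> x [c [_ + _]]; rewrite F0 big_set0 => /eqP.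
  by rewrite eq_sym oner_eq0.
exists (tr2 n s + dotv n (pos v0) *: g).
  by apply: deg_leD => //; apply/deg_leZ/gk.
move=> x [c [_ c1 ->]]; rewrite tr2D gE /ev !mevalD mevalM mevalZ.
congr (_ + _ * _); rewrite -/(ev _ _) ev_lform dotv_sumr.
rewrite -[RHS]mul1r -c1 mulr_suml; apply: eq_bigr => v vF.
rewrite dotvZr; congr (_ * _); apply/eqP.
by rewrite -subr_eq0 -dotvBr nF.
Qed.

End Degrees.

(** * Existence of the projections and of the weak Hessian *)

Section Projections.
Context {R : realType} {d : nat} {V : finType}.
Variable pos : V -> 'rV[R]_d.
Local Notation poly := (mpoly d R).
Local Notation vec := 'rV[R]_d.
Implicit Types (S F T e : {set V}) (p q : poly) (s t : 'M[poly]_d).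

Lemma ip_hullE S (f : vec -> R) p q : (0 < #|S|)%N ->
  (forall x, hull pos S x -> f x = ev p x) ->
  ip pos S f (ev q) = pint pos S (p * q).
Proof.
by move=> S0 fp; rewrite -ipE; apply: eq_simplex_int => // x /fp ->.
Qed.

Lemma deg_leE (j : nat) q : deg_le j q ->
  q = \sum_(m : bmultinom d j.+1) mcoeff m q *: mpolyX R m.
Proof. exact: mpolywE. Qed.

Lemma deg_le_bmono (j : nat) (m : bmultinom d j.+1) : deg_le j (mpolyX R m).
Proof. by rewrite /deg_le msizeX; exact: bmdeg. Qed.

(** Semidefiniteness suffices for existence: an isotropic polynomial is orthogonal to [p] by
    Cauchy-Schwarz. Only integrals against test polynomials are claimed, since on a face the
    projection is determined only up to its restriction. *)
Lemma L2proj_spec S (j : nat) (f : vec -> R) p : (0 < #|S|)%N ->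
  (forall x, hull pos S x -> f x = ev p x) ->
  forall q, deg_le j q -> pint pos S (L2proj pos j S f * q) = pint pos S (p * q).
Proof.
move=> S0 fp.
have [|||c0 cc0|c cP] := @riesz_fin R poly (bmultinom d j.+1)
  (fun m => mpolyX R m) (fun p q => pint pos S (p * q)) (fun q => pint pos S (p * q)).
- by move=> a x y z; rewrite mulrDl -scalerAl pint_linear.
- by move=> x y; rewrite mulrC.
- by move=> a x y; rewrite mulrDr -scalerAr pint_linear.
- by move=> cc; rewrite mulrC; apply: pint_psd_eq0.
have H : deg_le j (L2proj pos j S f) /\ forall q, deg_le j q ->
    ip pos S (ev (L2proj pos j S f)) (ev q) = ip pos S f (ev q).
  apply: (xgetPex 0 (P := [set p | deg_le j p /\
    forall q, deg_le j q -> ip pos S (ev p) (ev q) = ip pos S f (ev q)])).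
  exists (\sum_(m : bmultinom d j.+1) c m *: mpolyX R m); split.
    by apply: deg_le_sum => m _; apply/deg_leZ/deg_le_bmono.
  by move=> q qj; rewrite ipE (ip_hullE _ S0 fp) (deg_leE qj) cP.
by move=> q qj; rewrite -ipE H.2 // (ip_hullE _ S0 fp).
Qed.

(** Scaling in ['M[poly]_d] takes polynomial coefficients, so combinations over [R] are formed
    entrywise. *)
Definition mxlin (a : R) s t : 'M[poly]_d := \matrix_(i, j) (a *: s i j + t i j).

Definition mx_linear (l : 'M[poly]_d -> R) : Prop :=
  forall a s t, l (mxlin a s t) = a * l s + l t.

Lemma mx_linear0 l : mx_linear l -> l 0 = 0.
Proof.
move=> ll; apply: (@addrI _ (l 0)); rewrite addr0.
have := ll 1 0 0; rewrite mul1r => <-; congr l.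
by apply/matrixP => i j; rewrite !mxE scaler0 addr0.
Qed.

Lemma mx_linear_sum (I : Type) (r : seq I) (P : pred I) (l : I -> 'M[poly]_d -> R) :
  (forall i, P i -> mx_linear (l i)) ->
  mx_linear (fun t => \sum_(i <- r | P i) l i t).
Proof.
move=> ll a s t; rewrite mulr_sumr -big_split /=.
by apply: eq_bigr => i Pi; rewrite ll.
Qed.

Lemma mx_linear_ip S s : (0 < #|S|)%N -> mx_linear (ip_mx pos S s).
Proof.
move=> S0 a t u; rewrite !ip_mxE mulr_sumr -big_split; apply: eq_bigr => i _ /=.
rewrite mulr_sumr -big_split; apply: eq_bigr => j _ /=.
by rewrite mxE mulrDr -scalerAr pint_linear.
Qed.

Lemma ip_mxC S s t : ip_mx pos S s t = ip_mx pos S t s.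
Proof.
by rewrite !ip_mxE; apply: eq_bigr => i _; apply: eq_bigr => j _; rewrite mulrC.
Qed.

Lemma nn_mxlin n a s t : nn n (mxlin a s t) = a *: nn n s + nn n t.
Proof.
rewrite /nn /vdot scaler_sumr -big_split; apply: eq_bigr => i _ /=.
rewrite scalerA mulrC -scalerA -scalerDr; congr (_ *: _).
rewrite /mxvec_prod scaler_sumr -big_split; apply: eq_bigr => j _ /=.
by rewrite mxE scalerDr !scalerA mulrC.
Qed.

Lemma mx_linear_nn S n p : (0 < #|S|)%N ->
  mx_linear (fun t => pint pos S (p * nn n t)).
Proof. by move=> S0 a s t; rewrite nn_mxlin mulrDr -scalerAr pint_linear. Qed.

Lemma sigma_mxlin k r a s t : Sigma k r s -> Sigma k r t ->
  Sigma k r (mxlin a s t).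
Proof.
move=> [s1 [s1T s1k] +] [t1 [t1T t1k] +].
have stk : sym_deg_le k (mxlin a s1 t1).
  split; first by apply/matrixP => i j; rewrite !mxE -{1}s1T -{1}t1T !mxE.
  by move=> i j; rewrite mxE; apply: deg_le_lin.
case: ifP => kr H1 H2; exists (mxlin a s1 t1) => //; rewrite kr.
  case: H1 => q qh ->; case: H2 => q' q'h ->.
  exists (a *: q + q'); first by apply: dhomogD => //; apply: dhomogZ.
  apply/matrixP => i j; rewrite !mxE mulrDr -scalerAr addrACA scalerDr.
  by [].
by rewrite H1 H2.
Qed.

Lemma sigma0 k r : Sigma k r (0 : 'M[poly]_d).
Proof.
have z : sym_deg_le k (0 : 'M[poly]_d).
  by split; [rewrite trmx0|move=> i j; rewrite mxE; apply: deg_le0].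
exists 0 => //; case: ifP => // _; exists 0; first exact: dhomog0.
by apply/matrixP => i j; rewrite !mxE mulr0 addr0.
Qed.

Lemma sigma_hessian k r p : (2 <= k)%N -> deg_le k p -> Sigma k r (hessian p).
Proof.
move=> k2 pk.
have z : sym_deg_le k (hessian p).
  split; first by apply/matrixP => i j; rewrite !mxE mderiv_comm.
  move=> i j; rewrite mxE; apply: (@deg_leW _ _ k.-2); first by lia.
  by rewrite -subn2 -addn1 -addn1 subnDA !subn1; do 2!apply: deg_le_mderiv.
exists (hessian p) => //; case: ifP => // _; exists 0; first exact: dhomog0.
by apply/matrixP => i j; rewrite !mxE mulr0 addr0.
Qed.

Local Notation mxfun := {ffun 'I_d * 'I_d -> poly}.

(** Finite functions carry the module structure over [R] that [riesz_fin] expects. *)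
Definition mxof (x : mxfun) : 'M[poly]_d := \matrix_(i, j) x (i, j).

Lemma mxof_lin a (x y : mxfun) : mxof (a *: x + y) = mxlin a (mxof x) (mxof y).
Proof. by apply/matrixP => i j; rewrite !mxE !ffunE. Qed.

(** Symmetrised elementary matrices times monomials, and [x x^T] times monomials of degree [k - 1].
    The family is redundant: each off-diagonal matrix occurs twice, and monomials of the wrong
    degree contribute 0. *)
Definition sigma_gen k r
    (b : ('I_d * 'I_d * bmultinom d k.+1) + bmultinom d k.-1.+1) : mxfun :=
  match b with
  | inl (i, j, m) => [ffun x =>
      (2^-1 * ((x == (i, j))%:R + (x == (j, i))%:R)) *: mpolyX R m]
  | inr m => if (r == k.-1) && (mdeg m == k.-1)
             then [ffun x => xxT (mpolyX R m) x.1 x.2] else 0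
  end.

Lemma sigma_gen_in k r b : Sigma k r (mxof (@sigma_gen k r b)).
Proof.
case: b => [[[i j] m]|m] /=.
  set s := mxof _; have z : sym_deg_le k s.
    split.
      apply/matrixP => i' j'; rewrite !mxE !ffunE; congr (_ * _ *: _).
      by rewrite !xpair_eqE addrC ![(_ == i) && _]andbC.
    by move=> i' j'; rewrite mxE ffunE; apply/deg_leZ/deg_le_bmono.
  exists s => //; case: ifP => // _; exists 0; first exact: dhomog0.
  by apply/matrixP => i' j'; rewrite !mxE mulr0 addr0.
case: ifP => [/andP[rk mk]|_]; last first.
  rewrite (_ : mxof _ = 0); first exact: sigma0.
  by apply/matrixP => i' j'; rewrite !mxE ffunE.
have z : sym_deg_le k (0 : 'M[poly]_d).
  by split; [rewrite trmx0|move=> i j; rewrite mxE; apply: deg_le0].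
exists 0 => //; rewrite rk; exists (mpolyX R m); first by rewrite dhomogX.
by apply/matrixP => i' j'; rewrite !mxE ffunE add0r !mxE.
Qed.

(** The coefficients of the entries can be taken as they are: the indices [(i, j)] and [(j, i)]
    contribute one half each, which symmetry adds up to the entry. *)
Lemma sigma_gen_span k r t : Sigma k r t ->
  exists c, t = mxof (\sum_b c b *: @sigma_gen k r b).
Proof.
move=> [s [sT sk] ts].
have sE i' j' : \sum_(b : 'I_d * 'I_d * bmultinom d k.+1)
    mcoeff b.2 (s b.1.1 b.1.2) *: @sigma_gen k r (inl b) (i', j') = s i' j'.
  pose G i j := (2^-1 * (((i', j') == (i, j))%:R + ((i', j') == (j, i))%:R) : R)
    *: s i j.
  transitivity (\sum_i \sum_j G i j).
    rewrite pair_big /= (eq_bigr (fun b => \sum_(m : bmultinom d k.+1)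
      mcoeff m (s b.1 b.2) *: @sigma_gen k r (inl (b, m)) (i', j'))).
      by rewrite pair_big /=; apply: eq_bigr => [[[i j] m]] _.
    move=> [i j] _; rewrite /G {1}(deg_leE (sk i j)) scaler_sumr.
    by apply: eq_bigr => m _; rewrite /= ffunE !scalerA mulrC.
  have d1 (F : 'I_d -> 'I_d -> poly) : \sum_i \sum_j
      (((i', j') == (i, j))%:R : R) *: F i j = F i' j'.
    rewrite (bigD1 i') //= [Z in _ + Z]big1 ?addr0 => [|i ii'].
      rewrite (bigD1 j') //= big1 ?addr0 => [|j jj'].
        by rewrite eqxx scale1r.
      by rewrite xpair_eqE [j' == j]eq_sym (negbTE jj') andbF scale0r.
    by apply: big1 => j _; rewrite xpair_eqE eq_sym (negbTE ii') scale0r.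
  transitivity (2^-1 *: (s i' j' + s j' i') : poly).
    rewrite -(d1 s) -(d1 (fun i j => s j i)) [Z in _ + Z]exchange_big /=.
    rewrite -big_split scaler_sumr; apply: eq_bigr => i _ /=.
    rewrite -big_split scaler_sumr; apply: eq_bigr => j _ /=.
    by rewrite /G -scalerDl scalerA.
  rewrite -[in s j' i']sT mxE -mulr2n -[s i' j' *+ 2]scaler_nat scalerA.
  by rewrite mulVf ?scale1r ?pnatr_eq0.
have [q qh tE] : exists2 q, (if r == k.-1 then q \is ishomog1 k.-1 mdeg
    else q == 0) & t = s + xxT q.
  case: ifP ts => [_ [q qh ->]|_ ->]; first by exists q.
  exists 0; first exact: eqxx.
  by apply/matrixP => i j; rewrite !mxE mulr0 addr0.
exists (fun b : ('I_d * 'I_d * bmultinom d k.+1) + bmultinom d k.-1.+1 =>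
  match b with inl b => mcoeff b.2 (s b.1.1 b.1.2)
                            | inr m => mcoeff m q end).
apply/matrixP => i' j'; rewrite tE mxE [RHS]mxE sum_ffunE big_sumType /=.
congr (_ + _).
  by rewrite -[LHS]sE; apply: eq_bigr => b _; rewrite ffunE.
rewrite mxE; case: (boolP (r == k.-1)) qh => [rk qh|rk /eqP ->]; last first.
  rewrite mulr0 big1 // => m _; rewrite mcoeff0 ffunE scale0r //.
have qk : deg_le k.-1 q.
  apply/deg_leP => m km; move: qh => /dhomog_nemf_coeff -> //.
  by rewrite gtn_eqF.
rewrite {1}(deg_leE qk) mulr_sumr; apply: eq_bigr => m _.
rewrite ffunE /=; case: (boolP (mdeg m == k.-1)) => mk.
  by rewrite ffunE mxE scalerAr.
rewrite ffunE; move: qh => /dhomog_nemf_coeff -> //.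
by rewrite !scale0r mulr0.
Qed.

Section Cell.
Variable T : {set V}.
Hypotheses (d2 : (2 <= d)%N) (indT : affinely_independent pos T)
  (cT : #|T| = d.+1).

Let T0 : (0 < #|T|)%N. Proof. by rewrite cT. Qed.
Let T1 : (1 < #|T|)%N. Proof. by rewrite cT ltnS ltnW. Qed.

Lemma ip_mx_definite t : ip_mx pos T t t = 0 -> t = 0.
Proof.
rewrite ip_mxE => /eqP; rewrite psumr_eq0 => [/allP tt|i _]; last first.
  by apply: sumr_ge0 => j _; apply: pint_sqr_ge0.
apply/matrixP => i j; rewrite mxE.
have := tt i (mem_index_enum _); rewrite /= psumr_eq0 => [/allP ti|l _]; last first.
  exact: pint_sqr_ge0.
have /eqP := ti j (mem_index_enum _).
exact: pint_definite.
Qed.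

Lemma sigma_riesz k r l : mx_linear l -> exists W, Sigma k r W /\
  forall t, Sigma k r t -> ip_mx pos T W t = l t.
Proof.
move=> ll.
have [a x y z|x y|a x y|c xx|c cP] := @riesz_fin R mxfun _ (@sigma_gen k r)
    (fun x y => ip_mx pos T (mxof x) (mxof y)) (fun x => l (mxof x)).
- by rewrite mxof_lin ip_mxC (mx_linear_ip _ T0) !(ip_mxC _ _ (mxof z)).
- exact: ip_mxC.
- by rewrite mxof_lin ll.
- by move=> /ip_mx_definite ->; apply: mx_linear0.
exists (mxof (\sum_b c b *: @sigma_gen k r b)); split.
  elim/big_rec: _ => [|b x _ Sx].
    rewrite (_ : mxof 0 = 0); first exact: sigma0.
    by apply/matrixP => i j; rewrite !mxE ffunE.
  by rewrite mxof_lin; apply: sigma_mxlin => //; apply: sigma_gen_in.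
by move=> t /sigma_gen_span [e ->]; rewrite cP.
Qed.

(** The components of [v] are arbitrary functions, so the defining right-hand side is not known to
    be linear in [t]. It is traded for a linear [l] that agrees with it on the shape functions. *)
Lemma whess_spec k r nF (v : weak_fun) l : mx_linear l ->
  (forall t, Sigma k r t ->
      ip pos T (w_0 v T) (ev (divv (row_div t)))
      - \sum_(F in facets T) ip pos F (w_b v F) (ev (tr2 (conormal pos T F) t))
      + \sum_(F in facets T)
          ip pos F (fun x => w_n v F x * dotv (nF F) (conormal pos T F))
               (ev (nn (conormal pos T F) t))
      + \sum_(e in ridges T) ip pos e (w_e v e) (ev (tr_e pos T e t)) = l t) ->
  Sigma k r (whess pos k r nF v T) /\
  forall t, Sigma k r t -> ip_mx pos T (whess pos k r nF v T) t = l t.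
Proof.
move=> ll vl; have [W [SW Wl]] := @sigma_riesz k r l ll.
have [SH Hl] := @xgetPex _ 0 [set W | Sigma k r W /\ forall t, Sigma k r t ->
    ip_mx pos T W t =
      ip pos T (w_0 v T) (ev (divv (row_div t)))
      - \sum_(F in facets T) ip pos F (w_b v F) (ev (tr2 (conormal pos T F) t))
      + \sum_(F in facets T)
          ip pos F (fun x => w_n v F x * dotv (nF F) (conormal pos T F))
               (ev (nn (conormal pos T F) t))
      + \sum_(e in ridges T) ip pos e (w_e v e) (ev (tr_e pos T e t))]
  (ex_intro _ W (conj SW (fun t St => etrans (Wl t St) (esym (vl t St))))).
by split=> // t St; rewrite -vl //; apply: Hl.
Qed.

End Cell.
End Projections.

(** * Properties that hold for all small positive parameters *)

Section Small.
Context {R : realType}.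
Implicit Types (P Q : R -> Prop).

Definition small P : Prop :=
  exists2 e0 : R, 0 < e0 & forall e, 0 < e -> e < e0 -> P e.

Lemma small_mono P Q : small P -> (forall e, 0 < e -> P e -> Q e) -> small Q.
Proof.
by move=> [e0 e00 H] PQ; exists e0 => // e e1 e2; apply: PQ => //; apply: H.
Qed.

Lemma small_and P Q : small P -> small Q -> small (fun e => P e /\ Q e).
Proof.
move=> [a a0 Pa] [b b0 Qb]; exists (Num.min a b); first by rewrite lt_min a0.
by move=> e e0; rewrite lt_min => /andP[ea eb]; split; [apply: Pa|apply: Qb].
Qed.

Lemma small_ex P : small P -> exists2 e, 0 < e & P e.
Proof.
move=> [a a0 Pa]; exists (a / 2); first by rewrite divr_gt0.
by apply: Pa; rewrite ?divr_gt0 // gtr_pMr // invf_lt1 ?ltr1n.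
Qed.

Lemma small_lt (a : R) : 0 < a -> small (fun e => e < a).
Proof. by move=> a0; exists a. Qed.

Lemma small_fin (I : finType) (P : I -> R -> Prop) :
  (forall i, small (P i)) -> small (fun e => forall i, P i e).
Proof.
move=> H.
have {H} : forall s : seq I, small (fun e => forall i, i \in s -> P i e).
  elim=> [|i s IH]; first by exists 1.
  apply: small_mono (small_and (H i) IH) _ => e _ [Pi Ps] j.
  by rewrite inE => /predU1P[->|/Ps].
by move/(_ (enum I)) => /small_mono; apply => e _ H i; apply: H; rewrite mem_enum.
Qed.

Lemma small_lin (a b : R) : 0 < b -> small (fun e => 0 < b + e * a).
Proof.
move=> b0.
have a1 : 0 < `|a| + 1 by rewrite ltr_wpDl.
exists (b / (`|a| + 1)); first by rewrite divr_gt0.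
move=> e e0; rewrite ltr_pdivlMr // => eb.
have : - (e * `|a|) <= e * a.
  by rewrite -mulrN ler_pM2l // lerNl -normrN ler_norm.
by move=> ?; nra.
Qed.

Lemma small_lin_neg (a b : R) : b < 0 -> small (fun e => b + e * a < 0).
Proof.
move=> b0; have := @small_lin (- a) (- b); rewrite oppr_gt0 => /(_ b0).
by move=> /small_mono; apply => e _; rewrite mulrN -opprD oppr_gt0.
Qed.

Lemma small_open (d : nat) (O : set 'rV[R]_d) x a : open O -> O x ->
  small (fun e => O (x + e *: a)).
Proof.
move=> oO Ox.
have /nbhs_ballP [e0 /= e00 be] : nbhs x O by apply: open_nbhs_nbhs.
have := @small_fin 'I_d (fun i e => 0 < e0 + e * - `|a 0 i|)
  (fun i => small_lin _ e00).
move=> /small_mono; apply => e ep H; apply: be; split=> // i j.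
rewrite ord1 -ball_normE /= !mxE opprD addrA subrr sub0r normrN normrM.
by have := H j; rewrite mulrN subr_gt0 (gtr0_norm ep).
Qed.

End Small.

(** * Cells near their facets *)

Section Geometry.
Context {R : realType} {d : nat} {V : finType}.
Variable pos : V -> 'rV[R]_d.
Local Notation poly := (mpoly d R).
Local Notation vec := 'rV[R]_d.
Implicit Types (S F T : {set V}) (a n x : vec) (c : V -> R) (e : R).

Lemma hullW F S x : F \subset S -> hull pos F x -> hull pos S x.
Proof.
move=> FS [c [c0 c1 ->]]; exists (fun v => if v \in F then c v else 0); split.
- by move=> v _; case: ifP => // /c0.
- by rewrite sum_mask.
- by rewrite sum_scale_mask.
Qed.

Lemma bary_unique S c c' : affinely_independent pos S ->
  \sum_(v in S) c v = \sum_(v in S) c' v ->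
  \sum_(v in S) c v *: pos v = \sum_(v in S) c' v *: pos v ->
  forall v, v \in S -> c v = c' v.
Proof.
move=> indS e1 e2 v vS; apply/eqP; rewrite -subr_eq0; apply/eqP.
apply: (indS (fun v => c v - c' v)) => //.
- by rewrite sumrB e1 subrr.
- by under eq_bigr do rewrite scalerBl; rewrite sumrB e2 subrr.
Qed.

Lemma dotv_hull_facet F n v0 x : unit_normal pos F n -> v0 \in F ->
  hull pos F x -> dotv n x = dotv n (pos v0).
Proof.
move=> [_ nF] v0F [c [_ c1 ->]]; rewrite dotv_sumr -[RHS]mul1r -c1 mulr_suml.
apply: eq_bigr => v vF; rewrite dotvZr; congr (_ * _).
by apply/eqP; rewrite -subr_eq0 -dotvBr nF.
Qed.

Section Cell.
Variable T : {set V}.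
Hypotheses (d2 : (2 <= d)%N) (indT : affinely_independent pos T)
  (cT : #|T| = d.+1).

Let T0 : (0 < #|T|)%N. Proof. by rewrite cT. Qed.
Let T1 : (1 < #|T|)%N. Proof. by rewrite cT ltnS ltnW. Qed.

(** The part of [n] orthogonal to the conormal is tangent to [F], hence orthogonal to [n], hence to
    itself. *)
Lemma unit_normal_unique F n : F \in facets T -> unit_normal pos F n ->
  n = dotv n (conormal pos T F) *: conormal pos T F /\
  dotv n (conormal pos T F) ^+ 2 = 1.
Proof.
move=> FT nF; set n1 := conormal pos T F.
have n1F : unit_normal pos F n1 by apply: conormal_unit.
have [n11 _] := n1F; have [n11' _] := nF.
set k := dotv n n1; pose b := n - k *: n1.
have bn1 : dotv b n1 = 0 by rewrite dotvBl dotvZl n11 mulr1 subrr.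
have tb : tangent pos F b by apply: (tangent_facet indT).
have nb : dotv n b = 0 by apply: tangent_normal tb.
have b0 : b = 0.
  by apply: dotv_eq0; rewrite {1}/b dotvBl dotvZl nb (dotvC n1) bn1 mulr0 subrr.
have nE : n = k *: n1 by apply/eqP; rewrite -subr_eq0 -/b b0.
split=> //; rewrite expr2 -[RHS]n11' [in RHS]nE dotvZl dotvZr n11 mulr1.
by [].
Qed.

Lemma full_bary x : exists2 c, \sum_(v in T) c v = 1 &
  x = \sum_(v in T) c v *: pos v.
Proof.
have /card_gt0P [v0 v0T] := T0.
have [c [_ c0 cE]] := tangent_full (x - pos v0) indT cT.
exists (fun v => c v + (v == v0)%:R).
  rewrite big_split /= c0 add0r (bigD1 v0) //= eqxx big1 ?addr0 // => v.
  by move=> /andP[_ /negbTE ->].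
under eq_bigr do rewrite scalerDl; rewrite big_split /= -cE (bigD1 v0) //= eqxx.
rewrite big1 ?addr0 ?scale1r ?subrK // => v /andP[_ /negbTE ->].
by rewrite scale0r.
Qed.

(** Moving inward raises the coordinate of the opposite vertex from 0 at a positive rate; the other
    coordinates start positive and stay so for a while. *)
Lemma inward_hull F x c : F \in facets T -> (forall v, v \in F -> 0 < c v) ->
  \sum_(v in F) c v = 1 -> x = \sum_(v in F) c v *: pos v ->
  small (fun e => hull pos T (x - e *: conormal pos T F)).
Proof.
move=> /facetsP [v vT ->]; set F' := T :\ v => c0 c1 xE.
have [h [h0 nh _]] := gram_conormal indT vT T1.
set n := conormal pos T F' in nh *.
have [a [aT a0 aE]] := tangent_full (- n) indT cT.
have [n1 nF] : unit_normal pos F' n.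
  by apply: conormal_unit => //; apply: setD1_facet.
have av : 0 < a v.
  have : dotv n (- n) = - (h * a v).
    rewrite aE (dotv_tangent _ _ (dotv n (pos v) + h) a0) (bigD1 v) //=.
    rewrite big1 => [|w /andP[wT wv]].
      by rewrite opprD addrA subrr sub0r addr0 mulrN mulrC.
    by rewrite opprD addrA -dotvBr nh ?subrr ?mulr0 // !inE wv.
  rewrite dotvNr n1 => /oppr_inj e1.
  by rewrite -(pmulr_rgt0 _ h0) -e1 ltr01.
have := @small_fin R V (fun w e => w \in F' -> 0 < c w + e * a w).
move=> /(_ _) /small_mono; apply => [w|e e0 H].
  have [wF|wF] := boolP (w \in F'); last by exists 1.
  by have := small_lin (a w) (c0 w wF); move=> /small_mono; apply.
exists (fun w => (if w \in F' then c w else 0) + e * a w).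
have sumF (W : lmodType R) (G : V -> W) :
    \sum_(w in T) ((if w \in F' then c w else 0) + e * a w) *: G w =
    \sum_(w in F') c w *: G w + e *: \sum_(w in T) a w *: G w.
  under eq_bigr do rewrite scalerDl; rewrite big_split /=; congr (_ + _).
    rewrite (big_setD1 v) //= !inE eqxx scale0r add0r.
    by apply: eq_bigr => w ->.
  by rewrite scaler_sumr; apply: eq_bigr => w _; rewrite scalerA.
split.
- move=> w wT; case: ifP => [wF|/negbT]; first by apply/ltW/H.
  rewrite !inE wT andbT negbK => /eqP ->.
  by rewrite add0r mulr_ge0 ?ltW.
- have := sumF R^o (fun=> 1); rewrite /GRing.scale /= -!mulr_suml !mulr1.
  by rewrite c1 a0 mulr0 addr0.
- by rewrite sumF -xE -aE scalerN.
Qed.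

(** Over [T], the linear form of the conormal attains its maximum on [F]. *)
Lemma outward_not_hull F x e : F \in facets T -> hull pos F x -> 0 < e ->
  ~ hull pos T (x + e *: conormal pos T F).
Proof.
move=> FT xF e0; move: (FT) => /facetsP [v vT FE].
have [h [h0 nh _]] := gram_conormal indT vT T1.
rewrite -FE in nh; set n := conormal pos T F in nh *.
have nF : unit_normal pos F n by apply: conormal_unit.
have /card_gt0P [v0 v0F] := facet_gt0 d2 cT FT.
have le w : w \in T -> dotv n (pos w) <= dotv n (pos v0).
  move=> wT; have [->|wv] := eqVneq w v.
    by rewrite -subr_ge0 -dotvBr nh // ltW.
  rewrite -subr_ge0 -dotvBr; case: nF => _ -> //.
  by rewrite FE !inE wv.
move=> [c [c0 c1 cE]].
have := congr1 (dotv n) cE; rewrite dotvDr dotvZr (dotv_hull_facet nF v0F xF).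
have [-> _] := nF; rewrite mulr1 => eE.
have : dotv n (\sum_(w in T) c w *: pos w) <= dotv n (pos v0).
  rewrite dotv_sumr -[leRHS]mul1r -c1 mulr_suml; apply: ler_sum => w wT.
  by rewrite dotvZr ler_wpM2l ?c0 ?le.
by rewrite -eE gerDl leNgt e0.
Qed.

(** A point outside [T] has a negative barycentric coordinate, which remains negative under a small
    displacement. *)
Lemma not_hull_small x a : ~ hull pos T x ->
  small (fun e => ~ hull pos T (x + e *: a)).
Proof.
move=> xT; have [c c1 cE] := full_bary x.
have [v vT cv] : exists2 v, v \in T & c v < 0.
  apply: contrapT => H; apply: xT; exists c; split=> // v vT.
  by rewrite leNgt; apply/negP => cv; apply: H; exists v.
have [b [_ b0 bE]] := tangent_full a indT cT.
have := small_lin_neg (b v) cv; move=> /small_mono; apply => e e0 neg.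
move=> [c' [c'0 c'1 c'E]].
have := @bary_unique T c' (fun w => c w + e * b w) indT.
rewrite c'1 big_split /= c1 -mulr_sumr b0 mulr0 addr0 -c'E => /(_ erefl).
under eq_bigr do rewrite scalerDl -scalerA.
rewrite big_split /= -cE -scaler_sumr -bE => /(_ erefl v vT) c'v.
by move: neg; rewrite -c'v ltNge c'0.
Qed.

End Cell.
End Geometry.

(** * Faces of a conforming triangulation *)

Section Mesh.
Context {R : realType} {d : nat} {V : finType}.
Variables (pos : V -> 'rV[R]_d) (Omega : set 'rV[R]_d) (cells : {set {set V}}).
Local Notation poly := (mpoly d R).
Local Notation vec := 'rV[R]_d.
Implicit Types (F T : {set V}) (x : vec).
Hypotheses (d2 : (2 <= d)%N) (tri : triangulation pos Omega cells).

Let indT T : T \in cells -> affinely_independent pos T.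
Proof. exact: cells_affine tri T. Qed.

Let cT T : T \in cells -> #|T| = d.+1.
Proof. exact: cells_dim tri T. Qed.

Let T1 T : T \in cells -> (1 < #|T|)%N.
Proof. by move=> /cT ->; rewrite ltnS ltnW. Qed.

Lemma facets_sub T F : F \in facets T -> F \subset T.
Proof. by rewrite inE => /andP[]. Qed.

Lemma facets_cells T T' F : T \in cells -> T' \in cells -> F \in facets T ->
  F \subset T' -> F \in facets T'.
Proof.
by move=> Tc T'c FT FT'; rewrite inE FT' (card_facet (cT Tc) FT) cT /=.
Qed.

Lemma facet_barycenter T F : T \in cells -> F \in facets T ->
  (forall v, v \in F -> 0 < d%:R^-1 :> R) /\ \sum_(v in F) d%:R^-1 = 1 :> R.
Proof.
move=> Tc FT; have d0 : (0 < d)%N by apply: ltnW.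
split; first by move=> v _; rewrite invr_gt0 ltr0n.
rewrite sumr_const (card_facet (cT Tc) FT) -[LHS]mulr_natl mulfV // pnatr_eq0.
by rewrite -lt0n.
Qed.

Lemma inter_cells T T' F : T \in cells -> T' \in cells -> T != T' ->
  F \in facets T -> F \subset T' -> T :&: T' = F.
Proof.
move=> Tc T'c TT' FT FT'.
have FI : F \subset T :&: T' by rewrite finset.subsetI facets_sub.
apply/esym/eqP; rewrite eqEcard FI /= (card_facet (cT Tc) FT).
rewrite leqNgt; apply/negP => cI; move/negP: TT'; apply.
have TI : T :&: T' == T by rewrite eqEcard finset.subsetIl cT.
rewrite eqEcard !cT // leqnn andbT; apply/finset.setIidPl/eqP.
by [].
Qed.

(** If the conormals agreed, one point slightly inward from the barycentre of [F] would lie in both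
    cells, hence in [F] by conformity, although it has left the hyperplane of [F]. *)
Lemma conormal_opp T T' F : T \in cells -> T' \in cells -> T != T' ->
  F \in facets T -> F \subset T' -> conormal pos T' F = - conormal pos T F.
Proof.
move=> Tc T'c TT' FT FT'.
have FT'f := facets_cells Tc T'c FT FT'.
have n'F := conormal_unit (indT T'c) (T1 T'c) FT'f.
have [n'E] := unit_normal_unique d2 (indT Tc) (cT Tc) FT n'F.
set k := dotv _ _ in n'E * => /eqP; rewrite sqrf_eq1 => /orP[]/eqP kE; last first.
  by rewrite n'E kE scaleN1r.
rewrite kE scale1r in n'E; exfalso.
have [b0 b1] := facet_barycenter Tc FT.
have h1 := inward_hull d2 (indT Tc) (cT Tc) FT b0 b1 erefl.
have h2 := inward_hull d2 (indT T'c) (cT T'c) FT'f b0 b1 erefl.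
rewrite n'E in h2; have [e e0 [y1 y2]] := small_ex (small_and h1 h2).
have : hull pos (T :&: T')
    (\sum_(v in F) d%:R^-1 *: pos v - e *: conormal pos T F).
  by rewrite -(cells_conforming tri) //; split.
rewrite (inter_cells Tc T'c TT' FT FT') => yF.
have nF := conormal_unit (indT Tc) (T1 Tc) FT.
have /card_gt0P [v0 v0F] := facet_gt0 d2 (cT Tc) FT.
have := dotv_hull_facet nF v0F yF.
rewrite dotvBr dotvZr; have [-> _] := nF.
rewrite (dotv_hull_facet nF v0F); last first.
  by exists (fun=> d%:R^-1); split=> // v /b0/ltW.
by move/eqP; rewrite mulr1 subr_eq addrC -subr_eq subrr eq_sym gt_eqF.
Qed.

(** Three cells around a face would have pairwise opposite conormals, making a unit vector equal to
    its negative. *)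
Lemma star_le2 T T' T'' F : T \in cells -> F \in facets T ->
  T' \in star cells F -> T'' \in star cells F -> T' != T -> T'' != T -> T' = T''.
Proof.
move=> Tc FT; rewrite !inE => /andP[T'c FT'] /andP[T''c FT''] T'T T''T.
apply/eqP/negPn/negP => T'T''.
have FT'f := facets_cells Tc T'c FT FT'.
have e1 := conormal_opp Tc T'c _ FT FT'.
have e2 := conormal_opp Tc T''c _ FT FT''.
have e3 := conormal_opp T'c T''c T'T'' FT'f FT''.
have [n1 _] := conormal_unit (indT Tc) (T1 Tc) FT.
move: e3; rewrite e1 1?eq_sym // e2 1?eq_sym // opprK => e3.
have := congr1 (dotv (conormal pos T F)) e3; rewrite dotvNr n1 => /eqP.
by rewrite -subr_eq0 -opprD oppr_eq0 -mulr2n pnatr_eq0.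
Qed.

Lemma star_cell T F : T \in cells -> F \in facets T -> T \in star cells F.
Proof. by move=> Tc FT; rewrite inE Tc facets_sub. Qed.

Lemma star_interior T F : T \in cells -> F \in facets T ->
  interior_face cells F ->
  exists2 T', star cells F = [set T; T']%SET & T' != T /\
    conormal pos T' F = - conormal pos T F.
Proof.
move=> Tc FT; rewrite /interior_face => /eqP s2.
have Ts := star_cell Tc FT.
have : #|star cells F :\ T| = 1%N by move: s2; rewrite (cardsD1 T) Ts => -[].
move/eqP/cards1P => [T' eT'].
have : T' \in star cells F :\ T by rewrite eT' inE.
rewrite !inE => /andP[T'T /andP[T'c FT']]; exists T'.
  by rewrite -eT' finset.setD1K.
by split=> //; apply: conormal_opp => //; rewrite eq_sym.
Qed.

Lemma star_boundary T F : T \in cells -> F \in facets T ->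
  ~~ interior_face cells F -> star cells F = [set T]%SET.
Proof.
move=> Tc FT; have Ts := star_cell Tc FT.
rewrite /interior_face (cardsD1 T) Ts add1n eqSS => s2.
have : #|star cells F :\ T| = 0%N.
  apply/eqP; move: s2; case E : #|_| => [|[|m]] // _.
  have /card_gt1P [T' [T'' [T's T''s /negP]]] : (1 < #|star cells F :\ T|)%N.
    by rewrite E.
  move: T's T''s; rewrite !inE => /andP[T'T T's] /andP[T''T T''s] [].
  by apply/eqP/(star_le2 Tc FT); rewrite ?inE.
move/eqP; rewrite cards_eq0 => /eqP s0.
by rewrite -(finset.setD1K Ts) s0 finset.setU0.
Qed.

(** Were [x] in the open set [Omega], so would be a nearby [y] in the relative interior of [F], and
    a point slightly outward from [y]. That point lies in no cell, contradicting the cover of the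
    closure. *)
Lemma boundary_face T F x : T \in cells -> F \in facets T ->
  ~~ interior_face cells F -> hull pos F x -> boundary Omega x.
Proof.
move=> Tc FT bF xF.
have cov y : closure Omega y <-> exists2 T', T' \in cells & hull pos T' y.
  by rewrite (omega_cover tri).
have clo y : hull pos F y -> closure Omega y.
  by move=> yF; apply/cov; exists T => //; apply: hullW yF; apply: facets_sub.
split; first exact: clo.
move=> Ox; have oO := omega_open tri.
have [b0 b1] := facet_barycenter Tc FT.
(* Moving from [x] towards the barycentre makes all weights on [F] positive. *)
pose z : vec := \sum_(v in F) d%:R^-1 *: pos v.
have [e e0 [Oy e1]] :=
  small_ex (small_and (small_open (z - x) oO Ox) (small_lt ltr01)).
case: xF => c [c0 c1 xE].
pose c' v := c v + e * (d%:R^-1 - c v).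
set y := x + _ in Oy.
have yE : y = \sum_(v in F) c' v *: pos v.
  rewrite /y /z xE -sumrB scaler_sumr -big_split /=; apply: eq_bigr => v _.
  by rewrite -scalerBl scalerA -scalerDl.
have c'0 v : v \in F -> 0 < c' v.
  move=> vF; have := c0 v vF; have := b0 v vF.
  rewrite /c'; set a := _^-1 => a0 cv.
  have -> : c v + e * (a - c v) = (1 - e) * c v + e * a by ring.
  by rewrite ltr_wpDl ?mulr_gt0 // mulr_ge0 // subr_ge0 ltW.
have c'1 : \sum_(v in F) c' v = 1.
  by rewrite big_split /= -mulr_sumr sumrB c1 b1 subrr mulr0 addr0.
have yF : hull pos F y by exists c'; split=> // v /c'0/ltW.
set n := conormal pos T F.
have H1 := small_open n oO Oy.
have H2 : small (fun e : R => forall T' : {set V}, T' \in cells ->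
    ~ hull pos T' (y + e *: n)).
  apply: (@small_fin R {set V} (fun T' e => T' \in cells ->
    ~ hull pos T' (y + e *: n))) => T'.
  have [T'c|T'c] := boolP (T' \in cells); last by exists 1.
  have [yT'|yT'] := pselect (hull pos T' y); last first.
    have H := not_hull_small (indT T'c) (cT T'c) n yT'.
    by apply: (small_mono H).
  (* A cell through [y] contains every vertex of [F], since all weights of [y] are positive; [F]
     being unshared, it is [T]. *)
  suff -> : T' = T.
    exists 1 => // e' e'0 _ _.
    exact: (outward_not_hull d2 (indT Tc) (cT Tc) FT yF).
  have yI : hull pos (T :&: T') y.
    rewrite -(cells_conforming tri) //; split=> //.
    by apply: hullW yF; apply: facets_sub.
  case: yI => c2 [_ c21 c2E].
  have FT' : F \subset T'.
    apply/fintype.subsetP => v vF; apply/negPn/negP => vT'.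
    pose f1 w := if w \in F then c' w else 0.
    pose f2 w := if w \in T :&: T' then c2 w else 0.
    have vT := fintype.subsetP (facets_sub FT) _ vF.
    have := @bary_unique R d V pos T f1 f2 (indT Tc).
    have IT : T :&: T' \subset T by apply: finset.subsetIl.
    rewrite /f1 /f2 (sum_mask _ (facets_sub FT)) (sum_mask _ IT).
    rewrite (sum_scale_mask _ _ (facets_sub FT)) (sum_scale_mask _ _ IT).
    rewrite c'1 c21 -yE -c2E.
    move=> /(_ erefl erefl v vT); rewrite vF inE (negbTE vT') andbF.
    by move=> c'v; have := c'0 v vF; rewrite c'v ltxx.
  have : T' \in star cells F by rewrite inE T'c.
  by rewrite (star_boundary Tc FT bF) inE => /eqP.
have [e' e'0 [Oy' nT]] := small_ex (small_and H1 H2).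
have /cov [T' T'c] := @subset_closure _ Omega _ Oy'.
exact: nT.
Qed.

Variables (k : nat) (u : vec -> R).
Hypothesis (uL : lagrange0 pos Omega cells k u).

Lemma piece_spec T : T \in cells -> deg_le k (piece pos k u T) /\
  forall x, hull pos T x -> u x = ev (piece pos k u T) x.
Proof.
move=> Tc; apply: (@xgetPex _ 0 [set p | deg_le k p /\
  forall x, hull pos T x -> u x = ev p x]).
by have [_ _ /(_ T Tc) [p pk pu]] := uL; exists p.
Qed.

End Mesh.

(** Algebra on one cell. With [W] the weak Hessian, [H] the Hessian, [G] the weak Hessian of the
    jump and [J] the jump form: [w = (Wu, Wv)], [hw = (Hu, Wv)], [jw = Ju(Wv)], [h = (Hu, Hv)],
    [jvh = Jv(Hu)], [x = (Wv, Gu)], [juh = Ju(Hv)], [jg = Jv(Gu)], [g = (Gu, Gv)]. Evaluating [x] in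
    two ways determines [jw]. *)
Lemma cross_terms (R : numFieldType) (s w hw jw h jvh x juh jg g : R) :
  s ^+ 2 = 1 -> w = hw - 2^-1 * jw -> hw = h - 2^-1 * jvh ->
  x = s * jw -> x = s * juh - 2^-1 * jg -> g = s * jg ->
  w = h - 2^-1 * (juh + jvh) + 4^-1 * g.
Proof.
move=> s2 -> -> xj xjg gE.
have -> : jw = juh - 2^-1 * g.
  rewrite gE -[LHS]mul1r -s2 expr2 -mulrA -xj xjg mulrBr mulrA -expr2 s2 mul1r.
  by rewrite mulrCA.
by field.
Qed.

(** * The weak Hessian of the embedding and the bilinear form *)

Section CDG.
Context {R : realType} {d : nat} {V : finType}.
Variables (pos : V -> 'rV[R]_d) (Omega : set 'rV[R]_d) (cells : {set {set V}}).
Variables (nF : {set V} -> 'rV[R]_d) (k r : nat).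
Local Notation poly := (mpoly d R).
Local Notation vec := 'rV[R]_d.
Implicit Types (F T : {set V}) (x : vec) (u v : vec -> R) (t : 'M[poly]_d).
Hypotheses (d2 : (2 <= d)%N) (tri : triangulation pos Omega cells).
Hypotheses (nFP : forall F, F \in faces cells -> unit_normal pos F (nF F)).
Hypotheses (k2 : (2 <= k)%N) (kr : r = (k - 2)%N \/ r = (k - 1)%N).

Let indT T : T \in cells -> affinely_independent pos T.
Proof. exact: cells_affine tri T. Qed.

Let cT T : T \in cells -> #|T| = d.+1.
Proof. exact: cells_dim tri T. Qed.

Let T0 T : T \in cells -> (0 < #|T|)%N.
Proof. by move=> /cT ->. Qed.

Let T1 T : T \in cells -> (1 < #|T|)%N.
Proof. by move=> /cT ->; rewrite ltnS ltnW. Qed.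

Local Notation piece := (piece pos k).
Local Notation jump_dn := (jump_dn pos cells k nF).
Local Notation avg_dnn := (avg_dnn pos cells k).
Local Notation H u T := (hessian (piece u T)).

Lemma facet_faces T F : T \in cells -> F \in facets T -> F \in faces cells.
Proof. by move=> Tc FT; apply/bigcupP; exists T. Qed.

Lemma dotv_facet_normal T F : T \in cells -> F \in facets T ->
  nF F = dotv (nF F) (conormal pos T F) *: conormal pos T F /\
  dotv (nF F) (conormal pos T F) ^+ 2 = 1.
Proof.
move=> Tc FT; apply: (unit_normal_unique d2 (indT Tc) (cT Tc) FT).
exact/nFP/(facet_faces Tc).
Qed.

Definition trace_dn u F : poly :=
  if interior_face cells F
  then average cells (fun T => dirder (nF F) (piece u T)) F else 0.

Lemma dirderZ (b : R) (n : vec) (p : poly) : dirder (b *: n) p = b *: dirder n p.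
Proof.
have := dirder_linear b n 0 p; rewrite addr0 => ->.
by rewrite (_ : dirder 0 p = 0) ?addr0 // /dirder big1 // => i _; rewrite mxE scale0r.
Qed.

(** On an interior face the two conormals are opposite, so average and half jump add up to the trace
    from [T]. On a boundary face the factor 2 in the jump makes the right-hand side vanish, in
    agreement with the zero extension. *)
Lemma trace_dn_jump u T F : T \in cells -> F \in facets T ->
  dotv (nF F) (conormal pos T F) *: trace_dn u F =
  dirder (conormal pos T F) (piece u T) - 2^-1 *: jump_dn u F.
Proof.
move=> Tc FT; rewrite /trace_dn /Defs.jump_dn /jump.
have [nE s2] := dotv_facet_normal Tc FT.
set s := dotv _ _ in nE s2 *; set n := conormal pos T F in nE s2 *.
have h2 : 2 != 0 :> R by rewrite pnatr_eq0.
case: ifPn => iF; last first.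
  rewrite scaler0 (star_boundary d2 tri Tc FT iF) big_set1 scalerA mulVf //.
  by rewrite scale1r subrr.
have [T' sE [T'T n'E]] := star_interior d2 tri Tc FT iF.
have sum2 (G : {set V} -> poly) : \sum_(S in star cells F) G S = G T + G T'.
  by rewrite sE big_setU1 ?big_set1 // inE eq_sym.
rewrite /average !sum2 n'E dotvNr -/s scaleNr -scalerBr.
have -> : dirder n (piece u T) = s *: dirder (nF F) (piece u T).
  by rewrite nE dirderZ scalerA -expr2 s2 scale1r.
set a := dirder _ _; set b := dirder _ _.
rewrite !scalerA [2^-1 * s]mulrC scalerDr scalerBr opprB addrC addrCA.
congr (_ + _).
apply/eqP; rewrite eq_sym subr_eq -scalerDl; apply/eqP; congr (_ *: _).
by rewrite -mulrDr -div1r -splitr mulr1.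
Qed.

Definition jump_form u T t : R :=
  \sum_(F in facets T) pint pos F (jump_dn u F * nn (conormal pos T F) t).

Lemma jump_form_linear u T : T \in cells -> mx_linear (jump_form u T).
Proof.
move=> Tc; apply: mx_linear_sum => F FT; apply: mx_linear_nn.
exact: facet_gt0 d2 (cT Tc) _ FT.
Qed.

(** An orientation constant on the cell factors out of the sum over its facets as the scalar [s]. *)
Lemma whess_jump_spec (m : {set V} -> {set V} -> vec) (s : R) u T :
  T \in cells ->
  (forall F, F \in facets T -> dotv (m T F) (conormal pos T F) = s) ->
  Sigma k r (whess_jump pos cells k r nF m u T) /\
  forall t, Sigma k r t ->
    ip_mx pos T (whess_jump pos cells k r nF m u T) t = s * jump_form u T t.
Proof.
move=> Tc ms; apply: (whess_spec d2 (indT Tc) (cT Tc)).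
  move=> a t t'; rewrite (jump_form_linear u Tc) mulrDr !mulrA; congr (_ + _).
  by rewrite [s * a]mulrC.
move=> t _ /=.
have zero (S : {set V}) q : (0 < #|S|)%N -> ip pos S (fun=> 0) (ev q) = 0.
  move=> S0; rewrite (ip_hullE (p := 0) _ S0) ?mul0r ?pint0 // => x _.
  by rewrite /ev meval0.
rewrite zero ?T0 // big1 => [|F FT]; last first.
  by apply: zero; apply: facet_gt0 d2 (cT Tc) _ FT.
rewrite [Z in _ + Z]big1 => [|e]; last first.
  rewrite inE => /andP[_ /eqP ce]; apply: zero.
  by move: d2; rewrite -ltnS -(cT Tc) -ce !ltnS.
rewrite subrr add0r addr0 mulr_sumr; apply: eq_bigr => F FT.
have F0 := facet_gt0 d2 (cT Tc) FT.
rewrite (ip_hullE (p := s *: jump_dn u F) _ F0) => [|x _].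
  by rewrite -scalerAl pintZ.
by rewrite ms // /ev mevalZ mulrC.
Qed.

Lemma whess_CDG_spec u T : lagrange0 pos Omega cells k u -> T \in cells ->
  Sigma k r (whess_CDG pos Omega cells k r nF u T) /\
  forall t, Sigma k r t ->
    ip_mx pos T (whess_CDG pos Omega cells k r nF u T) t =
    ip_mx pos T (H u T) t - 2^-1 * jump_form u T t.
Proof.
move=> uL Tc; have [_ u0 _] := uL.
have [pk up] := piece_spec uL Tc.
set p := piece u T in pk up *.
apply: (whess_spec d2 (indT Tc) (cT Tc)).
  move=> a t t'; rewrite (mx_linear_ip _ _ (T0 Tc)) (jump_form_linear u Tc).
  by ring.
move=> t St; rewrite (green_hessian d2 (indT Tc) (cT Tc)) /=.
have F0 F : F \in facets T -> (0 < #|F|)%N by apply: facet_gt0 d2 (cT Tc) F.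
have uh (S : {set V}) x : S \subset T -> hull pos S x -> u x = ev p x.
  by move=> ST xS; apply: up; apply: hullW xS.
have e1 : ip pos T (ev (L2proj pos r T u)) (ev (divv (row_div t))) =
    ip pos T (ev p) (ev (divv (row_div t))).
  rewrite !ipE (L2proj_spec (T0 Tc) up) //.
  exact: sigma_divdiv kr St.
have e2 F : F \in facets T ->
    ip pos F (if interior_face cells F then ev (L2proj pos k.-1 F u) else fun=> 0)
      (ev (tr2 (conormal pos T F) t)) =
    ip pos F (ev p) (ev (tr2 (conormal pos T F) t)).
  move=> FT; have FsT := facets_sub FT.
  case: ifPn => iF; last first.
    (* On a boundary face the component is zero by definition and [u] vanishes there by
       [boundary_face]. *)
    apply: eq_simplex_int; first exact: F0.
    move=> x xF; rewrite -(uh F) // u0 //.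
    exact: (boundary_face d2 tri Tc FT iF).
  have n1 := conormal_unit (indT Tc) (T1 Tc) FT.
  have [g gk gE] := sigma_tr2 k2 St n1.
  transitivity (pint pos F (L2proj pos k.-1 F u * g)).
    by rewrite -ipE; apply: eq_simplex_int; [exact: F0|move=> x xF; rewrite gE].
  rewrite (L2proj_spec (F0 F FT) (p := p)) => [|x|//]; last exact: uh.
  by rewrite -ipE; apply: eq_simplex_int; [exact: F0|move=> x xF; rewrite gE].
have e3 F : F \in facets T ->
    ip pos F (fun x => (if interior_face cells F
      then ev (average cells (fun T => dirder (nF F) (piece u T)) F)
      else fun=> 0) x * dotv (nF F) (conormal pos T F))
      (ev (nn (conormal pos T F) t)) =
    ip pos F (ev (dirder (conormal pos T F) p)) (ev (nn (conormal pos T F) t))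
    - 2^-1 * pint pos F (jump_dn u F * nn (conormal pos T F) t).
  move=> FT; rewrite (ip_hullE (p := dotv (nF F) (conormal pos T F) *: trace_dn u F)).
  - by rewrite trace_dn_jump // mulrBl pintB ?F0 // ipE -scalerAl pintZ // F0.
  - exact: F0.
  - move=> x _; rewrite /ev mevalZ mulrC /trace_dn; congr (_ * _).
    by case: ifP => // _; rewrite meval0.
have e4 (e : {set V}) : e \in ridges T ->
    ip pos e (if interior_ridge pos Omega e then u else fun=> 0) (ev (tr_e pos T e t)) =
    ip pos e (ev p) (ev (tr_e pos T e t)).
  rewrite inE => /andP[eT /eqP ce]; apply: eq_simplex_int.
    by move: d2; rewrite -ltnS -(cT Tc) -ce !ltnS.
  move=> x xe; rewrite -(uh e) //; case: ifPn => //.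
  by rewrite negbK => /asboolP /(_ x xe) /u0 ->.
rewrite e1 (eq_bigr _ e2) (eq_bigr _ e3) (eq_bigr _ e4) /=.
rewrite sumrB /jump_form mulr_sumr.
by rewrite [in LHS]addrA [RHS]addrAC.
Qed.

Lemma star_facets (G : {set V} -> {set V} -> R) :
  \sum_(T in cells) \sum_(F in facets T) G T F =
  \sum_(F in faces cells) \sum_(T in star cells F) G T F.
Proof.
rewrite (exchange_big_dep (mem (faces cells))) /= => [|T F Tc FT].
  apply: eq_bigr => F /bigcupP [T' T'c FT']; apply: eq_bigl => T.
  apply/andP/idP => [[Tc FT]|]; first by rewrite inE Tc facets_sub.
  rewrite inE => /andP[Tc FT]; split=> //.
  exact: (facets_cells tri T'c Tc FT' FT).
exact: facet_faces FT.
Qed.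

(** The jump is the same from all cells around a face, while the normal-normal traces add up to
    twice the average under both the interior and the boundary convention. *)
Lemma sum_jump_form u v : \sum_(T in cells) jump_form u T (H v T) =
  2 * \sum_(F in faces cells) ip pos F (ev (jump_dn u F)) (ev (avg_dnn v F)).
Proof.
rewrite star_facets mulr_sumr; apply: eq_bigr => F Ff.
have F0 : (0 < #|F|)%N.
  by have /bigcupP [T Tc FT] := Ff; apply: facet_gt0 d2 (cT Tc) F FT.
rewrite ipE (_ : jump_dn u F * avg_dnn v F = 2^-1 *: (jump_dn u F *
    \sum_(T in star cells F) nn (conormal pos T F) (H v T))); last first.
  by rewrite scalerAr.
by rewrite pintZ // mulrA mulfV ?pnatr_eq0 // mul1r mulr_sumr pint_sum.
Qed.

(** Formulated for a sign on each cell so as to cover both the outward normals and cellwise oriented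
    fixed normals. *)
Lemma CDG_identity (m : {set V} -> {set V} -> vec) u v :
  lagrange0 pos Omega cells k u -> lagrange0 pos Omega cells k v ->
  (forall T, T \in cells -> exists2 s : R, s ^+ 2 = 1 &
     forall F, F \in facets T -> dotv (m T F) (conormal pos T F) = s) ->
  ip_cells pos cells (whess_CDG pos Omega cells k r nF u)
                     (whess_CDG pos Omega cells k r nF v)
    = a_CDG pos cells k r nF m u v.
Proof.
move=> uL vL mP; rewrite /a_CDG.
transitivity (\sum_(T in cells) (ip_mx pos T (H u T) (H v T)
  - 2^-1 * (jump_form u T (H v T) + jump_form v T (H u T))
  + 4^-1 * ip_mx pos T (whess_jump pos cells k r nF m u T)
                       (whess_jump pos cells k r nF m v T))).
  apply: eq_bigr => T Tc; have [s s2 ms] := mP T Tc.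
  have [Su uE] := whess_CDG_spec uL Tc.
  have [Sv vE] := whess_CDG_spec vL Tc.
  have [Gu GuE] := whess_jump_spec u Tc ms.
  have [Gv GvE] := whess_jump_spec v Tc ms.
  have [puk _] := piece_spec uL Tc; have [pvk _] := piece_spec vL Tc.
  have Hu : Sigma k r (H u T) by apply: sigma_hessian.
  have Hv : Sigma k r (H v T) by apply: sigma_hessian.
  have E1 := uE _ Sv; have E2 := vE _ Hu; have E3 := GuE _ Sv.
  have E4 := vE _ Gu; have E5 := GuE _ Hv; have E6 := GvE _ Gu.
  have E2' := etrans (ip_mxC pos T (H u T) _) E2.
  have E3' := etrans (ip_mxC pos T (whess_CDG pos Omega cells k r nF v T) _) E3.
  rewrite (ip_mxC pos T (H v T) (H u T)) in E2'.
  rewrite (ip_mxC pos T (H v T)) E5 in E4.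
  have E6' := etrans (ip_mxC pos T (whess_jump pos cells k r nF m u T) _) E6.
  exact: (cross_terms s2 E1 E2' E3' E4 E6').
rewrite big_split sumrB -!mulr_sumr; congr (_ - _ + _).
rewrite big_split /=.
apply: (etrans (congr2 (fun a b => 2^-1 * (a + b)) (sum_jump_form u v)
                                                 (sum_jump_form v u))).
rewrite -mulrDr mulrA mulVf ?pnatr_eq0 // mul1r -big_split /=.
apply: eq_bigr => F _; rewrite addrC; congr (_ + _).
by rewrite !ipE mulrC.
Qed.

End CDG.

Theorem lemma4p8 (R : realType) (d : nat) (V : finType) (pos : V -> 'rV[R]_d)
    (Omega : set 'rV[R]_d) (cells : {set {set V}})
    (nF : {set V} -> 'rV[R]_d) (k r : nat) (u v : 'rV[R]_d -> R) :
  (2 <= d)%N ->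
  triangulation pos Omega cells ->
  (forall F, F \in faces cells -> unit_normal pos F (nF F)) ->
  (2 <= k)%N ->
  r = (k - 2)%N \/ r = (k - 1)%N ->
  lagrange0 pos Omega cells k u ->
  lagrange0 pos Omega cells k v ->
  ip_cells pos cells (whess_CDG pos Omega cells k r nF u)
                     (whess_CDG pos Omega cells k r nF v)
    = a_CDG pos cells k r nF (fun T F => conormal pos T F) u v
  /\
  (cellwise_oriented pos cells nF ->
   ip_cells pos cells (whess_CDG pos Omega cells k r nF u)
                      (whess_CDG pos Omega cells k r nF v)
     = a_CDG pos cells k r nF (fun _ F => nF F) u v).
Proof.
move=> d2 tri nFP k2 kr uL vL.
have T1 T : T \in cells -> (1 < #|T|)%N.
  by move=> /(cells_dim tri) ->; rewrite ltnS ltnW.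
split=> [|ori]; apply: (CDG_identity d2 tri nFP k2 kr uL vL) => T Tc.
  exists 1; first by rewrite expr1n.
  by move=> F FT; have [] := conormal_unit (cells_affine tri Tc) (T1 T Tc) FT.
(* The common value [s] is a sign because [nF] is a unit normal; any one facet shows it. *)
have [s sP] := ori T Tc.
have /card_gt0P [w wT] : (0 < #|T|)%N by apply: ltnW; apply: T1.
have FT := setD1_facet wT.
exists s => //; rewrite -(sP _ FT).
by have [] := dotv_facet_normal d2 tri nFP Tc FT.
Qed.
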